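(* Let $f:\mathbb{R}^d\to[0,\infty)$ be a proper log-concave function. Then the following hold. (1) There is a Gaussian density pointwise less than or equal to $f$ if and only if $\limsup_{s\to\infty}{}^{(s)}\mu(\overline{E}(f,s))>0$. (2) If there is a Gaussian density pointwise less than or equal to $f$, then $\lim_{s\to\infty}{}^{(s)}\mu(\overline{E}(f,s))=\limsup_{s\to\infty}{}^{(s)}\mu(\overline{E}(f,s))$ (in particular the limit exists), and there is a sequence $\{s_i\}_{i=1}^\infty$ of positive reals with $\lim_{i\to\infty}s_i=\infty$ such that the John $s_i$-functions ${}^{(s_i)}J_f$ converge uniformly to a Gaussian density which is of maximal integral among those Gaussian densities that are pointwise less than or equal to $f$. (3) If there is a Gaussian density pointwise less than or equal to $f$, then any Gaussian density which is of maximal integral among those Gaussian densities that are pointwise less than or equal to $f$ is of height at least $\|f\|e^{-d}$.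
   Context: A function $f:\mathbb{R}^d\to[0,\infty)$ is log-concave if $f=e^{-\psi}$ for some convex $\psi:\mathbb{R}^d\to\mathbb{R}\cup\{\infty\}$; it is proper log-concave if moreover it is upper semi-continuous and has finite positive integral. $\|f\|$ is the $L_\infty$ norm. A ''Gaussian density'' on $\mathbb{R}^d$ is any function (not necessarily of integral 1) of the form $x\mapsto\alpha e^{-\langle A^{-1}(x-a),A^{-1}(x-a)\rangle}$ with $A\in\mathbb{R}^{d\times d}$ positive definite, $\alpha>0$, $a\in\mathbb{R}^d$; $\alpha$ is called its height. For a positive definite $A\in\mathbb{R}^{d\times d}$, $\alpha>0$, $a\in\mathbb{R}^d$, the $d$-symmetric ellipsoid $\overline{E}=(A\oplus\alpha)\mathbf{B}^{d+1}+a\subset\mathbb{R}^{d+1}$ (with $\mathbf{B}^{n}$ the Euclidean unit ball of $\mathbb{R}^n$, $A\oplus\alpha$ block-diagonal, and $\mathbb{R}^d$ identified with the span of the first $d$ basis vectors) has height function $\hslash_{\overline{E}}(x)=\alpha\sqrt{1-|A^{-1}(x-a)|^2}$ for $x\in A\mathbf{B}^d+a$ and $0$ otherwise. For $s>0$ the $s$-lifting of $f$ is ${}^{(s)}\overline{f}=\{(x,\xi)\in\mathbb{R}^{d+1}:|\xi|\le f(x)^{1/s}\}$, and the $s$-volume of $\overline{E}$ is ${}^{(s)}\mu(\overline{E})=\int_{\mathbb{R}^d}\hslash_{\overline{E}}^s$. There is a unique $d$-symmetric ellipsoid of maximal $s$-volume contained in ${}^{(s)}\overline{f}$, called the John $s$-ellipsoid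 $\overline{E}(f,s)$ of $f$; the John $s$-function of $f$ is ${}^{(s)}J_f=\hslash_{\overline{E}(f,s)}^s$. *)

(* Defs.v *)
From HB Require Import structures.
From mathcomp Require Import all_boot all_order all_algebra.
From mathcomp Require Import all_classical all_reals all_analysis.

Set Implicit Arguments.
Unset Strict Implicit.
Unset Printing Implicit Defensive.

Import Order.TTheory GRing.Theory Num.Theory.
Import numFieldNormedType.Exports.

Local Open Scope classical_set_scope.
Local Open Scope ring_scope.

Section tuple_product_measure.
Context d (T : measurableType d) (R : realType).
Variable nu : {sigma_finite_measure set T -> \bar R}.
Local Open Scope ereal_scope.

Definition tuple_consp n (p : T * n.-tuple T) : n.+1.-tuple T :=
  [tuple of p.1 :: p.2].

Lemma measurable_tuple_consp n :
  measurable_fun [set: T * n.-tuple T] (@tuple_consp n).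
Proof. exact: measurable_cons. Qed.

Section step.
Variables (n : nat) (mu : {sigma_finite_measure set (n.-tuple T) -> \bar R}).

Definition tuple_cons_measure : set (n.+1.-tuple T) -> \bar R :=
  pushforward (nu \x mu) (@tuple_consp n).

HB.instance Definition _ := Measure.copy tuple_cons_measure
  (measure_function_pushforward__canonical__measure_function_Measure
     (nu \x mu) (@measurable_tuple_consp n)).

Lemma tuple_cons_measure_sigma_finite : sigma_finite setT tuple_cons_measure.
Proof.
have [F FT Foo] : sigma_finite setT (nu \x mu).
  have /sigma_finiteP[A [AT ndA Aoo]] := sigma_finiteT nu.
  have /sigma_finiteP[B [BT ndB Boo]] := sigma_finiteT mu.
  exists (fun i => A i `*` B i).
    apply/seteqP; split => // -[x y] _.
    have : [set: T] x by []. have : [set: n.-tuple T] y by [].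
    rewrite AT BT => -[j _ Bjy] [i _ Aix]; exists (maxn i j) => //; split.
    - by move: x Aix; exact/subsetPset/ndA/leq_maxl.
    - by move: y Bjy; exact/subsetPset/ndB/leq_maxr.
  move=> i; have [? ?] := Aoo i; have [? ?] := Boo i.
  split; first exact: measurableX.
  by rewrite product_measure1E// lte_mul_pinfty// ge0_fin_numE.
pose g (t : n.+1.-tuple T) : T * n.-tuple T := (thead t, [tuple of behead t]).
have gK : cancel (@tuple_consp n) g.
  by move=> [a v]; congr pair; apply: val_inj.
have mg : measurable_fun setT g.
  apply/measurable_fun_pairP; split; last exact: measurable_behead.
  exact: measurable_tnth.
exists (fun i => g @^-1` F i).
  apply/seteqP; split => // t _.
  have : [set: T * n.-tuple T] (g t) by [].
  by rewrite FT => -[i _ Fi]; exists i.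
move=> i; have [mF Fi] := Foo i; split.
  by rewrite -[X in measurable X]setTI; exact: mg.
rewrite /tuple_cons_measure /pushforward -comp_preimage.
by rewrite (_ : g \o _ = id)//; apply/funext => x /=; rewrite gK.
Qed.

HB.instance Definition _ := Measure_isSigmaFinite.Build _ _ _
  tuple_cons_measure tuple_cons_measure_sigma_finite.

End step.

(* The n-fold product measure of nu on the product sigma-algebra. *)
Fixpoint tuple_measure n : {sigma_finite_measure set (n.-tuple T) -> \bar R} :=
  match n with
  | 0 => \d_([tuple] : 0.-tuple T)
  | m.+1 => tuple_cons_measure (tuple_measure m)
  end.

Lemma tuple_measure_box n (A : 'I_n -> set T) :
  (forall i, measurable (A i)) ->
  tuple_measure n [set t | forall i, A i (tnth t i)] = \prod_(i < n) nu (A i).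
Proof.
elim: n A => [|n IHn] A mA.
  rewrite big_ord0 /= diracE mem_set//; by case.
rewrite big_ord_recl /= /tuple_cons_measure /pushforward.
pose B := [set t : n.-tuple T | forall i, A (lift ord0 i) (tnth t i)].
have mB : measurable B.
  rewrite (_ : B = \big[setI/setT]_(i < n)
      ((@tnth n T ^~ i) @^-1` A (lift ord0 i))).
    apply: bigsetI_measurable => i _; rewrite -[X in measurable X]setTI.
    exact: measurable_tnth.
  apply/seteqP; split => t; rewrite -bigcap_seq => Bt i; first by move=> _.
  by apply: Bt; rewrite /= mem_index_enum.
rewrite (_ : _ @^-1` _ = A ord0 `*` B); last first.
  apply/seteqP; split => [[x t] /= At|[x t] /= [Ax Bt] i].
    split; first exact: (At ord0).
    by move=> i; have := At (lift ord0 i); rewrite tnthS.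
  by case: (unliftP ord0 i) => [j|] ->; rewrite ?tnthS.
by rewrite product_measure1E// (IHn (fun i => A (lift ord0 i))).
Qed.

End tuple_product_measure.

Section euclidean.
Context {R : realType}.

Section vectors.
Variable n : nat.
Implicit Types u v : 'cV[R]_n.

Definition dotp u v : R := \sum_i u i 0 * v i 0.

(* The library's norm `|u| on 'cV[R]_n is the sup norm. *)
Definition enorm u : R := Num.sqrt (dotp u u).

Definition unit_ball : set 'cV[R]_n := [set u | enorm u <= 1].

Definition posdefmx (A : 'M[R]_n) : Prop :=
  A^T = A /\ forall u, u != 0 -> 0 < dotp u (A *m u).

Definition col_of_tuple (t : n.-tuple (measurableTypeR R)) : 'cV[R]_n :=
  \col_i tnth t i.

Definition lebesgue_tuple
    : {sigma_finite_measure set (n.-tuple (measurableTypeR R)) -> \bar R} :=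
  tuple_measure (@lebesgue_measure R) n.

Definition integral_Rn (g : 'cV[R]_n -> R) : \bar R :=
  (\int[lebesgue_tuple]_t (g (col_of_tuple t))%:E)%E.

Definition norm_Linfty (g : 'cV[R]_n -> R) : \bar R :=
  Lnorm lebesgue_tuple +oo%E (fun t => (g (col_of_tuple t))%:E).

End vectors.

Section functional_john.
Variable d : nat.
Implicit Types (f g : 'cV[R]_d -> R) (psi : 'cV[R]_d -> \bar R).

Definition econvex psi : Prop :=
  forall (x y : 'cV[R]_d) (t : R), 0 <= t <= 1 ->
    (psi (t *: x + (1 - t) *: y)%R <= t%:E * psi x + (1 - t)%:E * psi y)%E.

Definition log_concave f : Prop :=
  exists psi, [/\ forall x, psi x != -oo%E, econvex psi &
    forall x, (f x)%:E = expeR (- psi x)%E].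

Definition upper_semicontinuous f : Prop :=
  lower_semicontinuous (fun x => (- f x)%:E).

Definition proper_log_concave f : Prop :=
  [/\ log_concave f, upper_semicontinuous f &
    (0 < integral_Rn f < +oo)%E].

Definition gaussian (A : 'M[R]_d) (alpha : R) (a x : 'cV[R]_d) : R :=
  alpha * expR (- dotp (invmx A *m (x - a)) (invmx A *m (x - a))).

Definition gaussian_density_of_height (alpha : R) g : Prop :=
  exists A a, [/\ posdefmx A, 0 < alpha & g = gaussian A alpha a].

Definition gaussian_density g : Prop :=
  exists alpha, gaussian_density_of_height alpha g.

Definition gaussian_density_below f g : Prop :=
  gaussian_density g /\ forall x, g x <= f x.

Definition maximal_gaussian_density_below f g : Prop :=
  gaussian_density_below f g /\
  forall h, gaussian_density_below f h -> (integral_Rn h <= integral_Rn g)%E.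

(* The triple (A, alpha, a) stands for the ellipsoid
   (A (+) alpha) B^(d+1) + a; distinct triples with A positive definite and
   0 < alpha give distinct ellipsoids. *)
Definition ellipsoid_data := ('M[R]_d * R * 'cV[R]_d)%type.
Implicit Type E : ellipsoid_data.

Definition is_ellipsoid E : Prop := let: (A, alpha, _) := E in
  posdefmx A /\ 0 < alpha.

Definition ellipsoid_set E : set 'cV[R]_(d + 1) := let: (A, alpha, a) := E in
  [set block_mx A 0 0 alpha%:M *m u + col_mx a 0 | u in @unit_ball (d + 1)].

Definition ellipsoid_height E (x : 'cV[R]_d) : R := let: (A, alpha, a) := E in
  if x \in [set A *m u + a | u in @unit_ball d]
  then alpha * Num.sqrt (1 - enorm (invmx A *m (x - a)) ^+ 2) else 0.

(* A point (x, xi) of R^d x R is the column z with usubmx z = x and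
   dsubmx z = xi. *)
Definition lifting f (s : R) : set 'cV[R]_(d + 1) :=
  [set z | `|dsubmx z 0 0| <= f (usubmx z) `^ s^-1].

Definition svolume (s : R) E : \bar R :=
  integral_Rn (fun x => ellipsoid_height E x `^ s).

Definition is_john_ellipsoid f (s : R) E : Prop :=
  [/\ is_ellipsoid E, ellipsoid_set E `<=` lifting f s &
    forall E', is_ellipsoid E' -> ellipsoid_set E' `<=` lifting f s ->
      (svolume s E' <= svolume s E)%E].

(* For 0 < s and f proper log-concave there is exactly one such ellipsoid, so
   the default value, of zero height, is not taken. *)
Definition john_ellipsoid f (s : R) : ellipsoid_data :=
  xget (0, 0, 0) [set E | is_john_ellipsoid f s E].

Definition john_svolume f (s : R) : \bar R := svolume s (john_ellipsoid f s).

Definition john_function f (s : R) (x : 'cV[R]_d) : R :=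
  ellipsoid_height (john_ellipsoid f s) x `^ s.

End functional_john.
End euclidean.

(* Main.v *)
(* After rescaling the semiaxes by sqrt(s/2), the s-th power of the height
   function of an ellipsoid is x |-> b (1 - (2/s)|A^-1 (x - a)|^2)_+^(s/2), which
   increases to the Gaussian b exp(-|A^-1 (x - a)|^2) as s tends to infinity,
   while its integral is b |det A| K_s with K_s tending to the Gaussian constant.
   So a Gaussian below f gives ellipsoids in all liftings of f, with s-volumes
   bounded below.  Conversely, as soon as one such density lies below f, the
   function f is bounded below on a cube, hence decays exponentially (it is
   log-concave and integrable); therefore the parameters (A, b, a) of the
   densities below f with b |det A| bounded below form a relatively compact set,
   and a limit point of John ellipsoids as s tends to infinity is a Gaussian
   below f whose integral is the limit of the s-volumes.  Finally, if g is a
   Gaussian of maximal integral below f with parameters A, b, a and x is a point,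
   then log-concavity puts the Gaussian with parameters A / sqrt 2,
   sqrt (b f(x)), (a + x)/2 below f, and comparing integrals gives
   f(x) <= 2^d b <= e^d b. *)
Require Import Defs.
From HB Require Import structures.
From mathcomp Require Import all_boot all_order all_algebra.
From mathcomp Require Import all_classical all_reals all_analysis.
From mathcomp Require Import perm measurable_realfun ess_sup_inf.
From mathcomp Require Import ring lra.
Import Order.TTheory GRing.Theory Num.Theory.
Import numFieldNormedType.Exports.
Local Open Scope classical_set_scope.
Local Open Scope ring_scope.
Set Implicit Arguments.
Unset Strict Implicit.
Unset Printing Implicit Defensive.

(** * Integration over [n]-tuples *)

(** John densities and Gaussians are both of the form [profile_density q A b a], so one integral
    formula, [b |det A|] times a constant of [q], and one compactness argument serve both. The
    latter sees [q] only through [q >= exp (-1)] on [[0, 1/2]], which holds for all [s >= 2] at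
    once; it is used with [s] fixed, to prove that a John ellipsoid exists, and with [s] tending to
    infinity. Compactness is a matter of degrees: the decay of [f] bounds [b |A i j|^(n+1)], while
    [b |det A|] has degree only [n] in the entries of [A]. A positive lower bound on [b |det A|]
    thus prevents both the escape of [A] and the collapse of [b]. Limit points are taken along
    ultrafilters, so that one choice makes all entries converge. The whole limit exists because
    every Gaussian below [f] bounds the s-volumes from below asymptotically, while each positive
    limit value of the s-volumes is the integral of some Gaussian below [f]; hence two limit values
    cannot differ. *)

Section integral_general.
Context {R : realType}.

(* No measurability is needed: the integral of a nonnegative function is a
   supremum over the simple functions below it. *)
Lemma ge0_integral_le d (T : measurableType d)
    (mu : {measure set T -> \bar R}) (g h : T -> \bar R) :
  (forall x, 0 <= g x)%E -> (forall x, g x <= h x)%E ->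
  (\int[mu]_x g x <= \int[mu]_x h x)%E.
Proof.
move=> g0 gh; rewrite !ge0_integralTE//; last first.
  by move=> x; apply: le_trans (gh x); exact: g0.
apply: ge_ereal_sup => _ [k kg <-]; apply: ereal_sup_ubound.
by exists k => // x; apply: le_trans (gh x); exact: kg.
Qed.

(** The image of Lebesgue measure under the affine map, multiplied by [|m|], gives half-open
    intervals their length, so uniqueness of Lebesgue measure identifies it. For negative [m] the
    preimage is closed on the other side, which does not change its length. *)
Lemma integral_affine (m e : R) (g : measurableTypeR R -> \bar R) : m != 0 ->
  measurable_fun [set: measurableTypeR R] g -> (forall x, 0 <= g x)%E ->
  (\int[lebesgue_measure]_x g (m * x + e)%R =
   (`|m|^-1)%:E * \int[lebesgue_measure]_x g x)%E.
Proof.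
move=> m0 mg g0.
have mphi : measurable_fun setT (fun x : measurableTypeR R =>
  m * x + e : measurableTypeR R).
  by apply: measurable_funD => //; apply: measurable_funM.
pose pfm : {measure set (measurableTypeR R) -> \bar R} :=
  measure_function_pushforward__canonical__measure_function_Measure
    (@lebesgue_measure R) mphi.
have k0 : 0 <= `|m|^-1 by rewrite invr_ge0.
pose k : {nonneg R} := NngNum k0.
have E A : measurable A -> mscale k (@lebesgue_measure R) A =
pfm A.
  move=> mA; pose k' : {nonneg R} := NngNum (normr_ge0 m).
  pose mu' : {measure set (measurableTypeR R) -> \bar R} := mscale k' pfm.
  rewrite /mscale/= (@lebesgue_measure_unique R mu')//; last first.
    move=> _ [[a b]] _ <- /=; rewrite /mu' /mscale/= /pfm/= /pushforward.
    have [mgt0|mlt0] := ltP 0 m.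
      rewrite (_ : _ @^-1` _ = `](a - e) / m, (b - e) / m]%classic); last first.
        by apply/seteqP; split=> x /=;
          rewrite !in_itv/= ltr_pdivrMr// ler_pdivlMr// ltrBlDr lerBrDr mulrC.
      rewrite !lebesgue_measure_itv/= !lte_fin ltr_pM2r ?invr_gt0// ltrD2r.
      case: ifPn => ab; last by rewrite mule0.
      by rewrite -EFinB -EFinD -EFinM; congr EFin; rewrite gtr0_norm//; field.
    have {mlt0}mlt0 : m < 0 by rewrite lt_neqAle m0.
    rewrite (_ : _ @^-1` _ = `[(b - e) / m, (a - e) / m[%classic); last first.
      by apply/seteqP; split=> x /=;
        rewrite !in_itv/= ltr_ndivlMr// ler_ndivrMr// ltrBlDr lerBrDr mulrC andbC.
    rewrite !lebesgue_measure_itv/= !lte_fin ltr_nM2r ?invr_lt0// ltrD2r.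
    case: ifPn => ab; last by rewrite mule0.
    by rewrite -EFinB -EFinD -EFinM; congr EFin; rewrite ltr0_norm//; field.
  by rewrite /mu' /mscale/= muleA -EFinM mulVf ?mul1e// normr_eq0.
transitivity (\int[pfm]_x g x)%E; first by rewrite ge0_integral_pushforward.
rewrite -(@ge0_integral_mscale _ _ _ _ _ _ k)//.
by apply: eq_measure_integral => A mA _ /=; rewrite -E.
Qed.
End integral_general.

Section tuple_integral.
Context {R : realType}.
Local Notation muT n := (@lebesgue_tuple R n).

Definition measurable_col n (G : 'cV[R]_n -> \bar R) :=
  measurable_fun setT (G \o @col_of_tuple R n).

Lemma measurable_col_comp n d (T : measurableType d) (G : 'cV[R]_n -> \bar R)
    (phi : T -> 'cV[R]_n) : measurable_col G ->
  (forall i, measurable_fun setT (fun y => phi y i 0)) ->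
  measurable_fun setT (G \o phi).
Proof.
move=> mG mphi.
pose psi y : n.-tuple (measurableTypeR R) := [tuple phi y i 0 | i < n].
have -> : G \o phi = (G \o @col_of_tuple R n) \o psi.
  apply/funext => y /=; congr G; apply/matrixP => i j.
  by rewrite !mxE tnth_mktuple ord1.
apply: measurableT_comp => //; apply/measurable_fun_tnthP => i.
rewrite (_ : _ \o _ = fun y => phi y i 0); first exact: mphi.
by apply/funext => y /=; rewrite tnth_mktuple.
Qed.

Lemma col_of_tuple_cons n (x : R) (t : n.-tuple (measurableTypeR R)) :
  col_of_tuple (@tuple_consp _ (measurableTypeR R) n (x,
    t)) = col_mx x%:M (col_of_tuple t) :> 'cV[R]_(1 + n).
Proof.
apply/matrixP => i j; rewrite !mxE; case: splitP => k ik.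
  by rewrite (_ : i = ord0) ?mxE ?ord1//; apply/val_inj; rewrite /= ik ord1.
rewrite (_ : i = lift ord0 k); last by apply/val_inj; rewrite /= ik.
by rewrite tnthS !mxE.
Qed.

Lemma measurable_col_comp_pair n (G : 'cV[R]_(1 + n) -> \bar R) : measurable_col G ->
  measurable_fun setT (fun p : measurableTypeR R * n.-tuple (measurableTypeR R) =>
    G (col_mx p.1%:M (col_of_tuple p.2))).
Proof.
move=> mG.
rewrite (_ : (fun _ =>
  _) = (G \o @col_of_tuple R n.+1) \o @tuple_consp _ (measurableTypeR R) n).
  by apply: measurableT_comp => //; exact: measurable_tuple_consp.
by apply/funext => -[x t] /=; rewrite -col_of_tuple_cons.
Qed.

Lemma integral_tuple_cons_pair n (G : 'cV[R]_(1 + n) -> \bar R) :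
  (forall v, 0 <= G v)%E -> measurable_col G ->
  (\int[muT n.+1]_t G (col_of_tuple t) =
   \int[@lebesgue_measure R \x muT n]_p G (col_mx p.1%:M (col_of_tuple p.2)))%E.
Proof.
move=> G0 mG; rewrite /lebesgue_tuple/= /tuple_cons_measure.
have mc := @measurable_tuple_consp _ (measurableTypeR R) n.
rewrite (@ge0_integral_pushforward _ _ _ _ _ _ mc)//.
rewrite preimage_setT; apply: eq_integral => -[x t] _.
by rewrite [LHS]/comp col_of_tuple_cons.
Qed.

Lemma integral_tuple_cons n (G : 'cV[R]_(1 + n) -> \bar R) :
  (forall v, 0 <= G v)%E -> measurable_col G ->
  (\int[muT n.+1]_t G (col_of_tuple t) =
   \int[lebesgue_measure]_x \int[muT n]_t G (col_mx x%:M (col_of_tuple t)))%E.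
Proof.
move=> G0 mG; rewrite integral_tuple_cons_pair//.
exact: (fubini_tonelli1 (m1 := @lebesgue_measure R) (m2 := muT n) _
  (measurable_col_comp_pair mG) (fun p => G0 _)).
Qed.

Lemma integral_tuple_cons_swap n (G : 'cV[R]_(1 + n) -> \bar R) :
  (forall v, 0 <= G v)%E -> measurable_col G ->
  (\int[muT n.+1]_t G (col_of_tuple t) =
   \int[muT n]_t \int[lebesgue_measure]_x G (col_mx x%:M (col_of_tuple t)))%E.
Proof.
move=> G0 mG; rewrite integral_tuple_cons_pair//.
exact: (fubini_tonelli2 (m1 := @lebesgue_measure R) (m2 := muT n) _
  (measurable_col_comp_pair mG) (fun p => G0 _)).
Qed.

End tuple_integral.

(** * Triangular affine changes of variables *)

Section linear_change.
Context {R : realType}.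
Local Notation muT n := (@lebesgue_tuple R n).

Lemma measurable_coord n (i : 'I_n) :
  measurable_fun setT (fun t => @col_of_tuple R n t i 0).
Proof.
rewrite (_ : (fun _ => _) = (@tnth _ (measurableTypeR R))^~ i); last first.
  by apply/funext => t; rewrite mxE.
exact: measurable_tnth.
Qed.

Lemma measurable_affine_coord n m (M : 'M[R]_(m, n)) (b : 'cV[R]_m) (i : 'I_m) :
  measurable_fun setT (fun t => (M *m @col_of_tuple R n t + b) i 0).
Proof.
under eq_fun do rewrite mxE mxE; apply: measurable_funD => //.
apply: measurable_sum => j; apply: measurable_funM => //.
exact: measurable_coord.
Qed.

Lemma measurable_col_affine n (M : 'M[R]_n) (b : 'cV[R]_n) (G : 'cV[R]_n -> \bar R) :
  measurable_col G -> measurable_col (fun v => G (M *m v + b)).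
Proof.
move=> mG; apply: (@measurable_col_comp _ _ _ _ G (fun t =>
  M *m col_of_tuple t + b)) => // i.
exact: measurable_affine_coord.
Qed.

Lemma measurable_col_fix_head n (x : R) (G : 'cV[R]_(1 + n) -> \bar R) :
  measurable_col G -> measurable_col (fun v => G (col_mx x%:M v)).
Proof.
move=> mG; apply: (@measurable_col_comp _ _ _ _ G (fun t =>
  col_mx x%:M (col_of_tuple t))) => // i.
under eq_fun do rewrite mxE.
by case: (fintype.split i) => j /=; [exact: measurable_cst|exact: measurable_coord].
Qed.

Lemma measurable_col_fix_tail n (v : 'cV[R]_n) (G : 'cV[R]_(1 + n) -> \bar R) :
  measurable_col G -> measurable_fun [set: measurableTypeR R] (fun x : R =>
    G (col_mx x%:M v)).
Proof.
move=> mG; apply: (@measurable_col_comp _ _ _ _ G (fun x : measurableTypeR R =>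
  col_mx x%:M v)) => // i.
under eq_fun do rewrite mxE.
case: (fintype.split i) => j /=; last exact: measurable_cst.
by under eq_fun do rewrite mxE ord1 eqxx mulr1n; exact: measurable_id.
Qed.

(** Induction on the dimension. With the tail fixed, the head coordinate of the image is [m x] plus
    a constant, so the head is integrated first by the one-dimensional formula; the tail is then
    transformed by a smaller triangular matrix. *)
Lemma integral_upper n (M : 'M[R]_n) (b : 'cV[R]_n) (G : 'cV[R]_n -> \bar R) :
  (forall i j : 'I_n, (j < i)%N -> M i j = 0) -> (forall i, M i i != 0) ->
  (forall v, 0 <= G v)%E -> measurable_col G ->
  (\int[muT n]_t G (M *m col_of_tuple t + b)%R =
   (\prod_i `|M i i|^-1)%:E * \int[muT n]_t G (col_of_tuple t))%E.
Proof.
elim: n M b G => [|n IHn] M b G UM M0 G0 mG.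
  rewrite big_ord0 mul1e; apply: eq_integral => t _.
  by congr G; rewrite [LHS]flatmx0 [RHS]flatmx0.
move: M b G UM M0 G0 mG; rewrite -[n.+1]/(1 + n)%N => M b G UM M0 G0 mG.
pose m := M 0 0; pose c : 'M[R]_(1, n) := @ursubmx _ 1 n 1 n M;
  pose M' : 'M[R]_n := @drsubmx _ 1 n 1 n M.
have ME : M = block_mx m%:M c 0 M'.
  rewrite -[LHS](@submxK _ 1 n 1 n); congr block_mx.
    by rewrite [LHS]mx11_scalar /m !mxE; congr (M _ _)%:M; apply/val_inj.
  by apply/matrixP => i j; rewrite !mxE UM//= ord1.
have E x v : M *m col_mx x%:M v + b =
    col_mx (m * x + (c *m v + usubmx b) 0 0)%:M (M' *m v + dsubmx b).
  rewrite ME mul_block_col mul0mx add0r -[X in (_ + X = _)](vsubmxK b) add_col_mx;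
    congr col_mx.
  rewrite [LHS]mx11_scalar; congr (_%:M).
  by rewrite -addrA [LHS]mxE -scalar_mxM [(_%:M) 0 0]mxE eqxx mulr1n.
rewrite (integral_tuple_cons_swap (G := fun v => G (M *m v + b)))//;
  last exact: measurable_col_affine.
transitivity (\int[muT n]_t ((`|m|^-1)%:E * \int[lebesgue_measure]_x G (col_mx x%:M (M'
  *m col_of_tuple t + dsubmx b))))%E.
  apply: eq_integral => t _.
  under eq_integral do rewrite E.
  rewrite (integral_affine _ (g := fun x =>
    G (col_mx x%:M (M' *m col_of_tuple t + dsubmx b))))//; first exact: M0.
  exact: measurable_col_fix_tail.
pose H (p : measurableTypeR R * n.-tuple (measurableTypeR R)) := G (col_mx p.1%:M (M'
  *m col_of_tuple p.2 + dsubmx b)).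
have mH : measurable_fun setT H.
  pose MM : 'M[R]_(1 + n) := block_mx 1%:M 0 0 M';
    pose bb : 'cV[R]_(1 + n) := col_mx 0 (dsubmx b).
  have := @measurable_col_comp_pair _ n _ (measurable_col_affine MM bb mG).
  congr measurable_fun; apply/funext => p; rewrite /H; congr G.
  by rewrite /MM /bb mul_block_col !mul0mx add0r mul1mx addr0 add_col_mx addr0.
have mGG : measurable_fun setT (fun t : n.-tuple (measurableTypeR R) =>
    \int[@lebesgue_measure R]_x H (x, t))%E.
  exact: (measurable_fun_fubini_tonelli_G H mH (fun p => G0 _)).
have mFF : measurable_fun setT (fun x : measurableTypeR R =>
    \int[muT n]_t G (col_mx x%:M (col_of_tuple t)))%E.
  exact: (measurable_fun_fubini_tonelli_F _ (measurable_col_comp_pair mG) (fun p =>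
    G0 _)).
have m0 : (0 <= (`|m|^-1)%:E)%E by rewrite lee_fin invr_ge0.
rewrite (ge0_integralZl _ measurableT mGG)//; last by move=> t _;
  apply: integral_ge0 => x _; exact: G0.
(* The order of integration is exchanged again, since the induction hypothesis applies to the slice
   of [G] with the head fixed. *)
rewrite -(fubini_tonelli H mH (fun p => G0 _)).
rewrite big_ord_recl EFinM -muleA; congr (_ * _)%E.
rewrite integral_tuple_cons// -(ge0_integralZl _ measurableT mFF)//; last 2 first.
- by move=> x _; apply: integral_ge0.
- by rewrite lee_fin prodr_ge0.
apply: eq_integral => x _; rewrite /H/= (IHn M' (dsubmx b) (fun v =>
  G (col_mx x%:M v)))//.
- congr (_%:E * _)%E; apply: eq_bigr => i _; rewrite !mxE; congr (`| M _ _ |^-1);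
  apply/val_inj => //=.
- by move=> i j ij; rewrite !mxE UM//= !add1n.
- by move=> i; rewrite !mxE (_ : rshift 1 i = lift ord0 i) ?M0//; apply/val_inj.
- exact: measurable_col_fix_head.
Qed.

(** Here the head acts on the tail only by the translation [c x], which the induction hypothesis
    absorbs into its offset; so the tail is integrated first and the head last. *)
Lemma integral_lower n (M : 'M[R]_n) (b : 'cV[R]_n) (G : 'cV[R]_n -> \bar R) :
  (forall i j : 'I_n, (i < j)%N -> M i j = 0) -> (forall i, M i i != 0) ->
  (forall v, 0 <= G v)%E -> measurable_col G ->
  (\int[muT n]_t G (M *m col_of_tuple t + b)%R =
   (\prod_i `|M i i|^-1)%:E * \int[muT n]_t G (col_of_tuple t))%E.
Proof.
elim: n M b G => [|n IHn] M b G UM M0 G0 mG.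
  rewrite big_ord0 mul1e; apply: eq_integral => t _.
  by congr G; rewrite [LHS]flatmx0 [RHS]flatmx0.
move: M b G UM M0 G0 mG; rewrite -[n.+1]/(1 + n)%N => M b G UM M0 G0 mG.
pose m := M 0 0; pose c : 'M[R]_(n, 1) := @dlsubmx _ 1 n 1 n M;
  pose M' : 'M[R]_n := @drsubmx _ 1 n 1 n M.
have ME : M = block_mx m%:M 0 c M'.
  rewrite -[LHS](@submxK _ 1 n 1 n); congr block_mx.
    by rewrite [LHS]mx11_scalar /m !mxE; congr (M _ _)%:M; apply/val_inj.
  by apply/matrixP => i j; rewrite !mxE UM//= ord1.
have E x v : M *m col_mx x%:M v + b =
    col_mx (m * x + (usubmx b) 0 0)%:M (M' *m v + (c *m x%:M + dsubmx b)).
  rewrite ME mul_block_col mul0mx addr0 -[X in (_ + X = _)](vsubmxK b) add_col_mx;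
    congr col_mx.
    rewrite [LHS]mx11_scalar; congr (_%:M).
    by rewrite [LHS]mxE -scalar_mxM [(_%:M) 0 0]mxE eqxx mulr1n.
  by rewrite addrCA addrA.
rewrite (integral_tuple_cons (G := fun v => G (M *m v + b)))//;
  last exact: measurable_col_affine.
pose P := \prod_i `|M' i i|^-1.
pose F x := (\int[muT n]_t G (col_mx x%:M (col_of_tuple t)))%E.
have mF : measurable_fun [set: measurableTypeR R] F.
  exact: (measurable_fun_fubini_tonelli_F _ (measurable_col_comp_pair mG) (fun p =>
    G0 _)).
have F0 x : (0 <= F x)%E by apply: integral_ge0.
have P0 : (0 <= P%:E)%E by rewrite lee_fin prodr_ge0.
transitivity (\int[lebesgue_measure]_x (P%:E * F (m * x + usubmx b 0 0)%R))%E.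
  apply: eq_integral => x _; under eq_integral do rewrite E.
  rewrite (IHn M' (c *m x%:M + dsubmx b) (fun v =>
    G (col_mx (m * x + usubmx b 0 0)%:M v)))//.
  - by move=> i j ij; rewrite !mxE UM//= !add1n.
  - by move=> i; rewrite !mxE (_ : rshift 1 i = lift ord0 i) ?M0//; apply/val_inj.
  - exact: measurable_col_fix_head.
rewrite (integral_affine _ (g := fun x => P%:E * F x)%E)//; last 3 first.
- exact: M0.
- by apply: measurable_funeM.
- by move=> x; exact: mule_ge0.
rewrite (ge0_integralZl _ measurableT mF)// integral_tuple_cons// muleA -EFinM
  big_ord_recl; congr ((_ * _)%:E * _)%E.
by apply: eq_bigr => i _; rewrite !mxE; congr (`| M _ _ |^-1); apply/val_inj => //=.
Qed.

End linear_change.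

(** * Radial profiles *)

Section radial.
Context {R : realType}.
Local Notation muT n := (@lebesgue_tuple R n).

Definition sqnorm n (v : 'cV[R]_n) : R := dotp v v.

Definition radial_integral n (q : R -> R) : \bar R :=
  integral_Rn (fun x : 'cV[R]_n => q (sqnorm x)).

Definition profile_density n (q : R -> R) (A : 'M[R]_n) (b : R) (a x : 'cV[R]_n) : R :=
  b * q (sqnorm (invmx A *m (x - a))).

Lemma sqnormE n (v : 'cV[R]_n) : sqnorm v = \sum_i v i 0 ^+ 2.
Proof. by apply: eq_bigr => i _; rewrite expr2. Qed.

Lemma sqnorm_ge0 n (v : 'cV[R]_n) : 0 <= sqnorm v.
Proof. by rewrite sqnormE sumr_ge0// => i _; exact: sqr_ge0. Qed.

Lemma measurable_radial n (q : R -> R) : measurable_fun [set: measurableTypeR R] q ->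
  measurable_col (fun v : 'cV[R]_n => (q (sqnorm v))%:E).
Proof.
move=> mq; apply/measurable_EFinP.
have msq : measurable_fun setT (fun t => sqnorm (@col_of_tuple R n t)).
  under eq_fun do rewrite sqnormE; apply: measurable_sum => i.
  by apply: measurable_funX; exact: measurable_coord.
exact: (measurableT_comp mq msq).
Qed.

Lemma sqnorm_perm n (s : {perm 'I_n}) (v : 'cV[R]_n) : sqnorm (perm_mx s *m v) = sqnorm v.
Proof.
rewrite -row_permE !sqnormE [RHS](reindex_inj (@perm_inj _ s)).
by apply: eq_bigr => i _; rewrite mxE.
Qed.

(* The permutation factor of the LUP decomposition of M preserves sqnorm, so
   triangular changes of variables suffice. *)
Lemma integral_radial_affine n (M : 'M[R]_n) (b : 'cV[R]_n) (q : R -> R) :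
  \det M != 0 -> measurable_fun [set: measurableTypeR R] q -> (forall t, 0 <= q t) ->
  (\int[muT n]_t (q (sqnorm (M *m col_of_tuple t + b)%R))%:E =
   (`|\det M|^-1)%:E * \int[muT n]_t (q (sqnorm (col_of_tuple t)))%:E)%E.
Proof.
move=> dM mq q0; case: n M b dM => [|n] M b dM.
  rewrite det_mx00 normr1 invr1 mul1e; apply: eq_integral => t _.
  by congr (q _)%:E; rewrite /sqnorm /dotp !big_ord0.
have /is_perm_mxP[s Ps] := cormen_lup_perm M.
have := cormen_lup_correct M; have := cormen_lup_detL M.
have := @cormen_lup_lower _ _ M; have := @cormen_lup_upper _ _ M.
move: Ps; case: (cormen_lup M) => [[P L] U] /= -> UU LL detL PLU.
have dU : \prod_i U i i = \det U.
  rewrite -det_tr det_trig; last by apply/is_trig_mxP => i j ij; rewrite mxE UU.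
  by apply: eq_bigr => i _; rewrite mxE.
have dE : `|\det M| = `|\det U|.
  have := congr1 (fun A => `|\det A|) PLU.
  by rewrite /= !det_mulmx detL mul1r normrM det_perm normr_sign mul1r.
have U0 i : U i i != 0.
  have : \prod_i U i i != 0 by rewrite dU -normr_eq0 -dE normr_eq0.
  by move/prodf_neq0; exact.
pose G v := (q (sqnorm (L *m v + perm_mx s *m b)))%:E.
have mq1 := @measurable_radial n.+1 q mq.
have mG : measurable_col G by exact: (measurable_col_affine L (perm_mx s *m b) mq1).
transitivity (\int[muT n.+1]_t (G (U *m col_of_tuple t + 0)%R))%E.
  apply: eq_integral => t _; rewrite /G addr0 mulmxA -[L *m U]PLU -mulmxA -mulmxDr.
  by rewrite sqnorm_perm.
rewrite integral_upper//; last by move=> v; rewrite lee_fin.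
have L0 (i j : 'I_n.+1) : (i < j)%N -> L i j = 0.
  by move=> ij; rewrite LL 1?ltnW// -val_eqE/= ltn_eqF.
have L1 i : L i i = 1 by rewrite LL// eqxx.
have L1' i : L i i != 0 by rewrite L1 oner_neq0.
rewrite /G (integral_lower (perm_mx s *m b) L0 L1' _ mq1); last first.
  by move=> v; rewrite lee_fin.
rewrite [X in (_ * (X%:E * _))%E]big1 ?mul1e; last first.
  by move=> i _; rewrite L1 normr1 invr1.
by rewrite dE -dU normr_prod prodfV.
Qed.

(** For a fixed profile, comparing integrals thereby amounts to comparing [b |det A|]. *)
Lemma integral_profile n (q : R -> R) (A : 'M[R]_n) (b : R) (a : 'cV[R]_n) :
  \det A != 0 -> measurable_fun [set: measurableTypeR R] q -> (forall t, 0 <= q t) ->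
  0 <= b ->
  integral_Rn (profile_density q A b a) = ((b * `|\det A|)%:E * radial_integral n q)%E.
Proof.
move=> dA mq q0 b0; rewrite /integral_Rn /profile_density.
under eq_integral do rewrite EFinM mulmxBr.
rewrite ge0_integralZl//; last 2 first.
- have := measurable_col_affine (invmx A) (- (invmx A *m a)) (@measurable_radial n q mq).
  exact.
- by move=> t _; rewrite lee_fin.
rewrite integral_radial_affine//; last by rewrite det_inv invr_neq0.
by rewrite det_inv normfV invrK muleA EFinM.
Qed.

(** The Gaussian is a product over the coordinates, each of which contributes the one-dimensional
    integral [sqrt pi]. *)
Lemma radial_integral_gauss n :
  radial_integral n (fun t => expR (- t)) = (Num.sqrt pi ^+ n)%:E.
Proof.
have mg : measurable_fun [set: measurableTypeR R] (fun t : R => expR (- t)).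
  exact: measurableT_comp.
elim: n => [|n IHn].
  rewrite /radial_integral /integral_Rn expr0.
  under eq_integral do rewrite /sqnorm /dotp big_ord0 oppr0 expR0.
  by rewrite integral_cst// mul1e /lebesgue_tuple/= diracT.
rewrite /radial_integral /integral_Rn (integral_tuple_cons (G := fun v =>
  (expR (- sqnorm v))%:E)); last 2 first.
- by move=> v; rewrite lee_fin expR_ge0.
- exact: (@measurable_radial n.+1 (fun t => expR (- t)) mg).
have E (x : R) (v : 'cV[R]_n) : expR (- sqnorm (col_mx x%:M v)) = gauss_fun x * expR (-
  sqnorm v).
  rewrite sqnormE big_split_ord/= big_ord1 opprD expRD; congr (expR (- _) * expR (- _)).
    by rewrite col_mxEu mxE eqxx mulr1n.
  by rewrite sqnormE; apply: eq_bigr => i _; rewrite col_mxEd.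
transitivity (\int[@lebesgue_measure R]_x ((Num.sqrt pi ^+ n)%:E * (gauss_fun x)%:E))%E.
  apply: eq_integral => x _; under eq_integral do rewrite E EFinM.
  have mE : measurable_fun setT (fun t => (expR (- sqnorm (@col_of_tuple R n t)))%:E).
    exact: (@measurable_radial n (fun t => expR (- t)) mg).
  rewrite (ge0_integralZl _ measurableT mE); last 2 first.
  - by move=> t _; rewrite lee_fin expR_ge0.
  - by rewrite lee_fin gauss_fun_ge0.
  by rewrite muleC -IHn.
have mE : measurable_fun [set: measurableTypeR R] (EFin \o @gauss_fun R).
  by apply/measurable_EFinP; exact: measurable_gauss_fun.
rewrite (ge0_integralZl _ measurableT mE); last 2 first.
- by move=> t _; rewrite lee_fin gauss_fun_ge0.
- by rewrite lee_fin exprn_ge0// sqrtr_ge0.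
by rewrite integralT_gauss -EFinM exprSr.
Qed.

End radial.

Section john_profile.
Context {R : realType}.
Implicit Types s t : R.

Definition gauss_profile t : R := expR (- t).

(* Num.sqrt vanishes on negative numbers, so for 0 < s this is
   (1 - 2 t / s)_+^(s / 2). *)
Definition john_profile s t : R := Num.sqrt (1 - 2 * t / s) `^ s.

Lemma john_profile_ge0 s t : 0 <= john_profile s t.
Proof. exact: powR_ge0. Qed.

Lemma measurable_gauss_profile : measurable_fun [set: measurableTypeR R] gauss_profile.
Proof. exact: measurableT_comp. Qed.

Lemma measurable_john_profile s : measurable_fun [set: measurableTypeR R] (john_profile
  s).
Proof.
apply: (measurableT_comp (measurable_powR s)).
apply: (measurableT_comp (continuous_measurable_fun (@sqrt_continuous R))).
by apply: measurable_funB => //; apply: measurable_funM => //; exact: measurable_funM.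
Qed.

Lemma sqrt_expR t : Num.sqrt (expR t) = expR (t / 2).
Proof.
rewrite (_ : expR t = expR (t / 2) ^+ 2); last first.
  by rewrite expr2 -expRD; congr expR; field.
by rewrite sqrtr_sqr ger0_norm// expR_ge0.
Qed.

(** This is [1 + y <= exp y] at [y = - 2t/s], raised to the power [s/2]. *)
Lemma john_profile_le_gauss s t : 0 < s -> john_profile s t <= gauss_profile t.
Proof.
move=> s0; rewrite /gauss_profile (_ : - t = (- (2 * t / s)) / 2 * s); last by field; lra.
rewrite expRM -sqrt_expR; apply: ge0_ler_powR; rewrite ?nnegrE ?sqrtr_ge0//;
  first exact: ltW.
by apply: ler_wsqrtr; exact: expR_ge1Dx.
Qed.

(** The inequality [1 + y <= exp y] is applied to the reciprocal: [1 / (1 - 2t/s) = 1 + y] with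
    [y = 2t / (s - 2t)]. *)
Lemma john_profile_ge s t : 0 < s -> 2 * t < s ->
  expR (- (t * s / (s - 2 * t))) <= john_profile s t.
Proof.
move=> s0 ts; have st0 : s - 2 * t != 0 by lra.
rewrite (_ : - _ = - (2 * t / (s - 2 * t)) / 2 * s); last by field.
rewrite expRM -sqrt_expR; apply: ge0_ler_powR; rewrite ?nnegrE ?sqrtr_ge0//;
  first exact: ltW.
apply: ler_wsqrtr; rewrite expRN.
rewrite (_ : 1 - 2 * t / s = (1 + 2 * t / (s - 2 * t))^-1); last first.
  rewrite (_ : 1 + _ = s / (s - 2 * t)) ?invf_div; last by field.
  by field; lra.
have : 0 < 1 + 2 * t / (s - 2 * t).
  rewrite (_ : 1 + _ = s / (s - 2 * t)); last by field.
  by rewrite divr_gt0//; lra.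
move=> h; rewrite lef_pV2 ?posrE ?expR_gt0//; exact: expR_ge1Dx.
Qed.

Lemma john_profile_half s t : 2 <= s -> 0 <= t -> 2 * t <= 1 -> expR (- 1) <=
  john_profile s t.
Proof.
move=> s2 t0 t1; apply: le_trans (john_profile_ge _ _); [|lra|lra].
rewrite ler_expR lerN2 ler_pdivrMr; last lra.
nra.
Qed.

(** From [1 + y^2 / 2 <= exp y] at [y = t / 2], which gives the 8. *)
Lemma sqr_le_expR t : 0 <= t -> t ^+ 2 <= 8 * expR (t / 2).
Proof.
move=> t0; have t20 : 0 <= t / 2 by lra.
have := expR_ge1Dxn 1 t20; rewrite (_ : 2`!%:R = 2 :> R)//.
move: (expR (t / 2)) => e; rewrite !expr2; nra.
Qed.

(** The difference is at most [8 t^2 / s * exp (-t)], and half of the exponential absorbs [t^2] at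
    the cost of another factor 8. The half that is kept makes the error integrable, as
    [john_const_ge] requires. *)
Lemma gauss_le_john_profile s t : 2 <= s -> 0 <= t ->
  gauss_profile t <= john_profile s t + 64 / s * gauss_profile (t / 2).
Proof.
move=> s2 t0; have s0 : 0 < s by lra.
have eE : gauss_profile t = gauss_profile (t / 2) * gauss_profile (t / 2).
  by rewrite /gauss_profile -expRD; congr expR; field.
have e2 : expR (t / 2) * gauss_profile (t / 2) = 1.
  by rewrite /gauss_profile expRN divff// gt_eqF// expR_gt0.
have g0 : 0 < gauss_profile (t / 2) by exact: expR_gt0.
have key : 8 * t ^+ 2 / s * gauss_profile t <= 64 / s * gauss_profile (t / 2).
  rewrite eE mulrA ler_pM2r// mulrAC ler_pM2r ?invr_gt0//.
  by have := sqr_le_expR t0; nra.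
rewrite -lerBlDl; apply: le_trans key; rewrite lerBlDl.
(* For [4 t >= s >= 2] the factor [8 t^2 / s] is at least 1, so the bound is trivial; otherwise
   [s - 2 t > s / 2] and [john_profile_ge] is effective. *)
have [ts|st] := leP s (4 * t).
  rewrite -[leLHS]mul1r -[leLHS]add0r lerD ?john_profile_ge0// ler_pM2r ?expR_gt0//.
  rewrite ler_pdivlMr// mul1r expr2; nra.
have st2 : 0 < s - 2 * t by lra.
rewrite -lerBlDr; apply: le_trans (john_profile_ge _ _) => //; last lra.
rewrite (_ : - (t * s / _) = - t + - (2 * t ^+ 2 / (s - 2 * t))); last by field;
  rewrite gt_eqF.
rewrite expRD -[X in X - _]mulr1 [X in _ - X]mulrC -mulrBr; apply: ler_wpM2l;
  first exact: expR_ge0.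
apply: le_trans (expR_ge1Dx _); rewrite lerD2l lerN2 ler_pdivrMr//.
rewrite mulrAC ler_pdivlMr// expr2; nra.
Qed.

Lemma john_profile_dist_gauss s t : 2 <= s -> 0 <= t ->
  `|john_profile s t - gauss_profile t| <= 64 / s.
Proof.
move=> s2 t0; have s0 : 0 < s by lra.
have := john_profile_le_gauss t s0; have := gauss_le_john_profile s2 t0.
have : gauss_profile (t / 2) <= 1 by rewrite /gauss_profile -[leRHS]expR0 ler_expR; lra.
have : 0 < 64 / s by rewrite divr_gt0.
move=> h1 h2 h3 h4; rewrite ler0_norm; last lra.
nra.
Qed.

Lemma cvg_powR I (F : set_system I) (FF : ProperFilter F) (y : I -> R) (l s : R) : 0 <
  s ->
  (forall i, 0 <= y i) -> y i @[i --> F] --> l -> y i `^ s @[i --> F] --> l `^ s.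
Proof.
move=> s0 y0 yl; have [l0|lpos|lE] := ltgtP l 0.
- exfalso; near F => i; have : y i < 0 by near: i; exact: (cvgr_lt l).
  by rewrite ltNge y0.
- have E : \forall i \near F, expR (s * ln (y i)) = y i `^ s.
    near=> i; rewrite /powR ifF//; apply/negbTE; rewrite gt_eqF//.
    by near: i; exact: (cvgr_gt l).
  have h : expR (s * ln (y i)) @[i --> F] --> l `^ s.
    have h1 : s * ln (y i) @[i --> F] --> s * ln l.
      by apply: cvgMl_tmp; exact: (cvg_comp _ _ yl (continuous_ln lpos)).
    rewrite /powR gt_eqF//.
    exact: (cvg_comp _ _ h1 (@continuous_expR R (s * ln l))).
  exact: cvg_trans (near_eq_cvg E) h.
(* At the limit 0, which John profiles do reach, the formula [exp (s ln y)] is of no help; instead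
   [y <= e^(1/s)] yields [y^s <= e]. *)
- rewrite lE powR0 ?gt_eqF//; apply/cvgrPdist_le => e e0.
  have e1 : 0 < e `^ s^-1 by rewrite powR_gt0.
  move: yl; rewrite lE => /cvgrPdist_le /(_ _ e1); apply: filterS => i.
  rewrite !sub0r !normrN !ger0_norm ?powR_ge0// => h.
  have := @ge0_ler_powR R s (ltW s0) (y i) (e `^ s^-1) (y0 i) (ltW e1) h.
  by rewrite -powRrM mulVf ?gt_eqF// powRr1// ltW.
Unshelve. all: by end_near. Qed.

Lemma cvg_john_profile I (F : set_system I) (FF : ProperFilter F) (T : I -> R) (t s :
  R) : 0 < s ->
  T i @[i --> F] --> t -> john_profile s (T i) @[i --> F] --> john_profile s t.
Proof.
move=> s0 Tt; apply: cvg_powR => //.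
have h : 1 - 2 * T i / s @[i --> F] --> 1 - 2 * t / s.
  apply: cvgB; first exact: cvg_cst.
  by apply: cvgMr_tmp; apply: cvgMl_tmp.
exact: (cvg_comp _ _ h (@sqrt_continuous R _)).
Qed.

End john_profile.

Section john_constant.
Context {R : realType}.
Variable n : nat.

Definition gauss_const : R := Num.sqrt pi ^+ n.

Lemma gauss_const_gt0 : 0 < gauss_const.
Proof. by rewrite exprn_gt0// sqrtr_gt0 pi_gt0. Qed.

Lemma radial_integral_gauss_profile : radial_integral n gauss_profile = gauss_const%:E.
Proof. exact: radial_integral_gauss. Qed.

Definition john_const (s : R) : R := fine (radial_integral n (john_profile s)).

Lemma radial_integral_le (q p : R -> R) : (forall t, 0 <= q t) -> (forall t,
  0 <= t -> q t <= p t) ->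
  (radial_integral n q <= radial_integral n p)%E.
Proof.
move=> q0 qp; apply: ge0_integral_le => t; rewrite lee_fin//.
by apply: qp; exact: sqnorm_ge0.
Qed.

Lemma radial_integral_ge0 (q : R -> R) : (forall t,
  0 <= q t) -> (0 <= radial_integral n q)%E.
Proof. by move=> q0; apply: integral_ge0 => t _; rewrite lee_fin. Qed.

Lemma radial_integral_john (s : R) : 0 < s ->
  radial_integral n (john_profile s) = (john_const s)%:E.
Proof.
move=> s0; rewrite fineK// ge0_fin_numE ?radial_integral_ge0//;
  last exact: john_profile_ge0.
apply: (@le_lt_trans _ _ (radial_integral n gauss_profile)).
  apply: radial_integral_le => t; first exact: john_profile_ge0.
  by move=> _; exact: john_profile_le_gauss.
by rewrite radial_integral_gauss_profile ltry.
Qed.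

Lemma john_const_ge0 (s : R) : 0 <= john_const s.
Proof. by rewrite fine_ge0// radial_integral_ge0// => t; exact: john_profile_ge0. Qed.

Lemma john_const_le (s : R) : 0 < s -> john_const s <= gauss_const.
Proof.
move=> s0; rewrite -lee_fin -radial_integral_john// -radial_integral_gauss_profile.
apply: radial_integral_le => t; first exact: john_profile_ge0.
by move=> _; exact: john_profile_le_gauss.
Qed.

(** The pointwise error bound is integrated; [exp (- |v|^2 / 2)] has a finite integral since it is
    the Gaussian composed with the dilation by [1 / sqrt 2]. *)
Lemma john_const_ge : exists C : R, forall s,
  2 <= s -> gauss_const - C / s <= john_const s.
Proof.
pose h t := gauss_profile (t / 2) : R.
have mh : measurable_fun [set: measurableTypeR R] h.
  apply: (measurableT_comp measurable_gauss_profile).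
  exact: measurable_funM.
have [c cE] : exists c, radial_integral n h = c%:E.
  pose M : 'M[R]_n := ((Num.sqrt 2)^-1)%:M.
  have dM : \det M != 0.
    by rewrite det_scalar expf_neq0// invr_neq0// gt_eqF// sqrtr_gt0.
  exists (`|\det M|^-1 * gauss_const).
  rewrite EFinM -radial_integral_gauss_profile -(integral_radial_affine 0)//;
    last 2 first.
  - exact: measurable_gauss_profile.
  - by move=> t; exact: expR_ge0.
  apply: eq_integral => t _; congr (gauss_profile _)%:E.
  rewrite addr0 mul_scalar_mx /sqnorm /dotp mulr_suml; apply: eq_bigr => i _.
  rewrite !mxE mulrACA -invfM -[Num.sqrt 2 * _]expr2 sqr_sqrtr// mulrC//.
exists (64 * c) => s s2; have s0 : 0 < s by lra.
rewrite lerBlDr -lee_fin EFinD -radial_integral_john// -radial_integral_gauss_profile.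
rewrite (_ : 64 * c / s = 64 / s * c); last by rewrite mulrAC.
have k0 : 0 <= 64 / s by rewrite divr_ge0// ltW.
rewrite EFinM -cE /radial_integral /integral_Rn -(ge0_integralZl _ measurableT
  (@measurable_radial R n h mh))//; last first.
  by move=> t _; rewrite lee_fin expR_ge0.
rewrite -ge0_integralD//; last 4 first.
- by move=> t _; rewrite lee_fin john_profile_ge0.
- exact: (@measurable_radial R n _ (measurable_john_profile s)).
- by move=> t _; rewrite -EFinM lee_fin mulr_ge0// expR_ge0.
- by apply: measurable_funeM; exact: (@measurable_radial R n h mh).
apply: ge0_integral_le => t; first by rewrite lee_fin expR_ge0.
by rewrite -EFinM -EFinD lee_fin gauss_le_john_profile// sqnorm_ge0.
Qed.

Lemma cvg_john_const : john_const s @[s --> +oo] --> gauss_const.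
Proof.
have [C hC] := john_const_ge.
apply: (@squeeze_cvgr _ _ _ _ (fun s => gauss_const - C / s) (fun=> gauss_const)).
- near=> s; have s2 : 2 <= s by near: s; apply: nbhs_pinfty_ge; rewrite num_real.
  by rewrite hC//= john_const_le//; lra.
- rewrite -[X in _ --> X]subr0; apply: cvgB; first exact: cvg_cst.
  rewrite -[X in _ --> X](mulr0 C); apply: cvgMl_tmp.
  apply/gtr0_cvgV0; last exact: cvg_id.
  by apply: nbhs_pinfty_gt; rewrite num_real.
- exact: cvg_cst.
Unshelve. all: by end_near. Qed.

End john_constant.

(** * Decay of integrable log-concave functions *)

(** The matrix determinant lemma: eliminating either off-diagonal block of [X] computes [\det X] in
    two ways. *)
Lemma det_rank1_update (R : comNzRingType) n (u : 'cV[R]_n) (v : 'rV[R]_n) :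
  \det (1%:M + u *m v) = 1 + (v *m u) 0 0.
Proof.
pose X := block_mx 1%:M (- u) v (1%:M : 'M[R]_1).
have E1 : block_mx 1%:M u 0 1%:M *m X = block_mx (1%:M + u *m v) 0 v 1%:M.
  by rewrite mulmx_block !mul1mx !mulmx1 !mul0mx !add0r addNr.
have E2 : block_mx 1%:M 0 (- v) 1%:M *m X = block_mx 1%:M (- u) 0 (1%:M + v *m u).
  rewrite mulmx_block !mul1mx !mulmx1 !mul0mx !addr0 addNr mulNmx mulmxN opprK.
  by rewrite [v *m u + _]addrC.
have := congr1 determinant E1; have := congr1 determinant E2.
rewrite !det_mulmx !det_lblock !det_ublock !det1 !mul1r !mulr1 => -> <-.
by rewrite det_mx11 !mxE eqxx mulr1n.
Qed.

Section ellipsoid_volume.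
Context {R : realType}.
Variable n : nat.

(** A John profile with one fixed [s] serves as test function in place of the indicator of a ball:
    it is at most 1 and vanishes where [sqnorm u > s / 2], and its integral is already known. So
    [kappa] is [john_const n s] and [sigma] is [s / 2]. *)
Lemma volume_lower_bound : exists kappa sigma : R, [/\ 0 < kappa, 0 < sigma &
  forall (f : 'cV[R]_n -> R) (A : 'M[R]_n) (c : 'cV[R]_n) (b : R),
    (forall x, 0 <= f x) -> 0 <= b ->
    (forall u, sqnorm u <= sigma -> b <= f (c + A *m u)) ->
    ((b * `|\det A| * kappa)%:E <= integral_Rn f)%E].
Proof.
have [s s2 Ks] : exists2 s : R, 2 <= s & 0 < john_const n s.
  near (pinfty_nbhs R) => s; exists s.
    by near: s; apply: nbhs_pinfty_ge; rewrite num_real.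
  near: s; apply: (cvgr_gt _ (@cvg_john_const R n)); exact: gauss_const_gt0.
exists (john_const n s), (s / 2); split => [//||f A c b f0 b0 bf]; first lra.
have [dA|dA] := eqVneq (\det A) 0.
  by rewrite dA normr0 mulr0 mul0r; apply: integral_ge0 => t _; rewrite lee_fin.
have s0 : 0 < s by lra.
rewrite EFinM -radial_integral_john// -(integral_profile c dA (measurable_john_profile
  s) (@john_profile_ge0 R s) b0).
apply: ge0_integral_le => t; rewrite lee_fin /profile_density.
  by rewrite mulr_ge0// john_profile_ge0.
set x := col_of_tuple t; set u := invmx A *m (x - c).
have xE : x = c + A *m u.
  by rewrite /u mulmxA mulmxV ?mul1mx ?subrKC// unitmxE unitfE.
have [us|su] := leP (sqnorm u) (s / 2).
  apply: le_trans (_ : b * 1 <= _); last by rewrite mulr1 xE; exact: bf.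
  apply: ler_wpM2l => //; apply: le_trans (john_profile_le_gauss _ s0) _.
  by rewrite /gauss_profile -[leRHS]expR0 ler_expR oppr_le0 sqnorm_ge0.
rewrite /john_profile ler0_sqrtr; first by rewrite powR0 ?mulr0// gt_eqF.
by rewrite subr_le0 ler_pdivlMr//; lra.
Unshelve. all: by end_near. Qed.

Lemma sqnorm_coord (u : 'cV[R]_n) i : u i 0 ^+ 2 <= sqnorm u.
Proof.
rewrite sqnormE (bigD1 i)//= lerDl; apply: sumr_ge0 => j _; exact: sqr_ge0.
Qed.

(** [sigma + 1] is a root-free upper bound for [sqrt sigma]. *)
Lemma sqnorm_coord_le (sigma : R) (u : 'cV[R]_n) i : 0 < sigma ->
  sqnorm u <= sigma -> `|u i 0| <= sigma + 1.
Proof.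
move=> s0 us; have := le_trans (sqnorm_coord u i) us.
rewrite -real_normK ?num_real//; have := normr_ge0 (u i 0).
move: `|u i 0| => a; rewrite expr2; nra.
Qed.

End ellipsoid_volume.

Section log_concave_decay.
Context {R : realType}.
Variables (n : nat) (f : 'cV[R]_n -> R).
Hypotheses (f0 : forall x, 0 <= f x) (lcf : log_concave f).

(** Stated with real levels [exp p], log-concavity needs neither logarithms of [f] nor the infinite
    values of [psi]: a level below [f x] forces [psi x] to be finite. *)
Lemma log_concave_expR (x y : 'cV[R]_n) (p q t : R) : 0 <= t <= 1 ->
  expR p <= f x -> expR q <= f y ->
  expR (t * p + (1 - t) * q) <= f (t *: x + (1 - t) *: y).
Proof.
move=> t01 px qy; have [psi [psiN cpsi fE]] := lcf.
have key z r : expR r <= f z <-> (psi z <= (- r)%:E)%E.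
  rewrite -lee_fin fE; case: (psi z) (psiN z) => [a| |]// _.
    by rewrite -EFinN/= !lee_fin ler_expR lerNr.
  rewrite /= lee_fin; split => [|]; first by rewrite leNgt expR_gt0.
  by rewrite leye_eq.
apply/key; move/key in px; move/key in qy.
have /andP[t0 t1] := t01; have t1' : 0 <= 1 - t by lra.
apply: le_trans (cpsi x y t t01) _.
apply: (@le_trans _ _ (t%:E * (- p)%:E + (1 - t)%:E * (- q)%:E)%E).
  by apply: leeD; apply: lee_wpmul2l; rewrite ?lee_fin.
by rewrite -!EFinM -EFinD lee_fin; lra.
Qed.

Lemma le_expR_level (x : 'cV[R]_n) (p : R) :
  (forall q, expR q <= f x -> q <= p) -> f x <= expR p.
Proof.
move=> h; have := f0 x; rewrite le_eqVlt => /orP[/eqP<-|fx0]; first exact: expR_ge0.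
by rewrite -[leLHS]lnK ?posrE// ler_expR h// lnK ?posrE.
Qed.

Variables (x0 : 'cV[R]_n) (rho m : R).
Hypotheses (rho0 : 0 < rho)
  (cube : forall x : 'cV[R]_n, (forall i, `|x i 0 - x0 i 0| <= rho) -> expR m <= f x)
  (intf : (integral_Rn f < +oo)%E).

(** If [f y >= exp q], then [f >= exp ((m + q) / 2)] on the half-size cube centered midway between
    [x0] and [y]. Its volume does not depend on [y], so the integral of [f] bounds [q]. *)
Lemma log_concave_bounded_above : exists N, forall y, f y <= expR N.
Proof.
have [kappa [sigma [k0 s0 vol]]] := @volume_lower_bound R n.
have intf0 : (0 <= integral_Rn f)%E by apply: integral_ge0 => t _; rewrite lee_fin.
have intfE : integral_Rn f = (fine (integral_Rn f))%:E by rewrite fineK// ge0_fin_numE.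
(* Chosen so that [2 r u] stays in the cube whenever [sqnorm u <= sigma]. *)
pose r := rho / (2 * (sigma + 1)).
have r0 : 0 < r by rewrite /r divr_gt0//; lra.
exists (2 * ln (fine (integral_Rn f) / (r ^+ n * kappa)) - m) => y;
  apply: le_expR_level => q qy.
have := vol f r%:M (2^-1 *: x0 + (1 - 2^-1) *: y) (expR (2^-1 * m + (1 - 2^-1) * q)) f0
  (expR_ge0 _).
have H u : sqnorm u <= sigma -> expR (2^-1 * m + (1 - 2^-1) * q) <= f (2^-1 *: x0 + (1
  - 2^-1) *: y + r%:M *m u).
  move=> us.
  rewrite (_ : _ + _ *m _ = 2^-1 *: (x0 + (2 * r) *: u) + (1 - 2^-1) *: y); last first.
    by rewrite scalerDr scalerA mulrA mulVf ?mul1r// mul_scalar_mx addrAC.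
  apply: log_concave_expR => //; first by apply/andP; split; lra.
  apply: cube => i; rewrite !mxE addrAC subrr add0r normrM ger0_norm; last lra.
  have := sqnorm_coord_le i s0 us => h.
  apply: (@le_trans _ _ (2 * r * (sigma + 1))); first by apply: ler_wpM2l => //; lra.
  by rewrite /r le_eqVlt; apply/orP; left; apply/eqP; field; lra.
move=> /(_ H); rewrite det_scalar intfE lee_fin ger0_norm;
  last by rewrite exprn_ge0// ltW.
rewrite -mulrA -ler_pdivlMr; last by rewrite mulr_gt0// exprn_gt0.
move=> h; have h1 : 0 < fine (integral_Rn f) / (r ^+ n * kappa) by apply: lt_le_trans
  h; exact: expR_gt0.
move: h; rewrite -[leRHS]lnK ?posrE// ler_expR; lra.
Qed.

(* f is at least exp (m - 1) on the convex hull of the cube and y, which contains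
   an ellipsoid whose j-th semiaxis direction is stretched by a multiple of
   y - x0; its volume, linear in |y_j - x0_j|, is bounded by the integral. *)
Lemma log_concave_level_bounded : exists2 L, 0 <= L &
  forall y j, expR (m - 1) <= f y -> `|y j 0 - x0 j 0| <= L.
Proof.
have [kappa [sigma [k0 s0 vol]]] := @volume_lower_bound R n.
have intf0 : (0 <= integral_Rn f)%E by apply: integral_ge0 => t _; rewrite lee_fin.
have intfE : integral_Rn f = (fine (integral_Rn f))%:E by rewrite fineK// ge0_fin_numE.
have I0 : 0 <= fine (integral_Rn f) by rewrite fine_ge0.
pose r := rho / (2 * (sigma + 1)).
have r0 : 0 < r by rewrite /r divr_gt0//; lra.
have rn0 : 0 < r ^+ n by rewrite exprn_gt0.
(* Makes [|tau * u j 0| <= 1/4], so that the weight [l] put on [y] below lies in [[0, 1/2]]. *)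
pose tau := 4^-1 / (sigma + 1).
have tau0 : 0 < tau by rewrite /tau divr_gt0//; lra.
pose B := fine (integral_Rn f) / (expR (m - 1) * kappa * r ^+ n).
have B0 : 0 <= B by rewrite /B divr_ge0// !mulr_ge0 ?expR_ge0// ltW.
exists ((B + 1) * (r / tau)) => [|y j ym].
  by rewrite mulr_ge0//; [lra|rewrite divr_ge0// ltW].
pose w := y - x0.
(* A dilation plus a rank-one term that pushes along [w] in proportion to [u_j]; its determinant is
   affine in [w_j], by [det_rank1_update]. *)
pose A : 'M[R]_n := r *: (1%:M + (tau / r) *: w *m delta_mx 0 j).
have AE u : A *m u = r *: u + (tau * u j 0) *: w.
  rewrite /A -scalemxAl mulmxDl mul1mx scalerDr; congr (_ + _).
  rewrite -mulmxA -rowE -!scalemxAl !scalerA.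
  rewrite [row j u]mx11_scalar mul_mx_scalar scalerA !mxE.
  by congr (_ *: _); field; rewrite gt_eqF.
have dA : \det A = r ^+ n * (1 + tau / r * w j 0).
  rewrite /A detZ det_rank1_update; congr (_ * (1 + _)).
  by rewrite -rowE !mxE.
have := vol f A (x0 + 4^-1 *: w) (expR (m - 1)) f0 (expR_ge0 _).
have H u : sqnorm u <= sigma -> expR (m - 1) <= f (x0 + 4^-1 *: w + A *m u).
  move=> us; pose l := 4^-1 + tau * u j 0.
  have tu : `|tau * u j 0| <= 4^-1.
    rewrite normrM gtr0_norm//; apply: (@le_trans _ _ (tau * (sigma + 1))).
      by apply: ler_wpM2l; [exact: ltW|exact: sqnorm_coord_le].
    by rewrite /tau divfK//; lra.
  have l01 : 0 <= l <= 2^-1.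
    by move: tu; rewrite ler_norml /l => /andP[? ?]; apply/andP; split; lra.
  have l1 : 1 - l != 0 by move: l01 => /andP[? ?]; lra.
  (* Each point of the ellipsoid is a convex combination of [y] and a point near [x0]; since
     [1 - l >= 1/2], the latter is displaced by at most [2 r |u_i|] in each coordinate and stays in
     the cube. *)
  rewrite (_ : _ + _ *m _ = l *: y + (1 - l) *: (x0 + (r / (1 - l)) *: u)); last first.
    rewrite AE [(1 - l) *: (_ + _)]scalerDr [(1 - l) *: (_ *: u)]scalerA mulrCA divff//
      mulr1 (_ : y = w + x0) ?subrK//.
    apply/matrixP => i k; rewrite !mxE /l; ring.
  apply: (@le_trans _ _ (expR (l * (m - 1) + (1 - l) * m))).
    by rewrite ler_expR; move: l01 => /andP[? ?]; lra.
  apply: log_concave_expR => //; first by move: l01 => /andP[? ?]; apply/andP; split; lra.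
  apply: cube => i; rewrite !mxE addrAC subrr add0r normrM ger0_norm; last first.
    by rewrite divr_ge0 ?(ltW r0)//; move: l01 => /andP[? ?]; lra.
  apply: (@le_trans _ _ (2 * r * (sigma + 1))).
    apply: ler_pM => //.
    - by rewrite divr_ge0 ?(ltW r0)//; move: l01 => /andP[? ?]; lra.
    - rewrite ler_pdivrMr; last by move: l01 => /andP[? ?]; lra.
      by move: l01 => /andP[? ?]; nra.
    - exact: sqnorm_coord_le.
  by rewrite /r le_eqVlt; apply/orP; left; apply/eqP; field; lra.
move=> /(_ H); rewrite intfE lee_fin dA normrM (gtr0_norm rn0) => h.
have {}h : `|1 + tau / r * w j 0| <= B.
  rewrite /B ler_pdivlMr; last by rewrite !mulr_gt0// expR_gt0.
  by apply: le_trans h; rewrite le_eqVlt; apply/orP; left; apply/eqP; ring.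
have {}h : `|tau / r * w j 0| <= B + 1.
  rewrite (_ : tau / r * _ = (1 + tau / r * w j 0) - 1); last by ring.
  by apply: le_trans (ler_normB _ _) _; rewrite normr1 lerD2r.
have -> : y j 0 - x0 j 0 = (tau / r * w j 0) * (r / tau).
  by rewrite /w !mxE; field; rewrite !gt_eqF.
by rewrite normrM [X in _ * X]ger0_norm ?ler_wpM2r// divr_ge0// ltW.
Qed.

(* On a ray from x0, f has dropped by a factor e at distance L, hence by e^-T at
   distance T L. *)
Lemma log_concave_decay : exists2 C, 0 <= C & forall y, f y <= C /\
  forall j, f y * `|y j 0 - x0 j 0| ^+ n.+1 <= C.
Proof.
have [N fN] := log_concave_bounded_above.
have [L' L'0 hL] := log_concave_level_bounded.
pose L := L' + 1; have L0 : 0 < L by rewrite /L; lra.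
have a0 : 0 <= expR N by exact: expR_ge0.
have b0 : 0 <= expR N * L ^+ n.+1 by rewrite mulr_ge0// exprn_ge0// ltW.
have c0 : 0 <= expR m * (n.+1)`!%:R * L ^+ n.+1.
  by rewrite !mulr_ge0 ?expR_ge0// exprn_ge0// ltW.
exists (expR N + expR N * L ^+ n.+1 + expR m * (n.+1)`!%:R * L ^+ n.+1); first lra.
move=> y; split; first by have := fN y; lra.
move=> j; have [wL|Lw] := leP `|y j 0 - x0 j 0| L.
  apply: (@le_trans _ _ (expR N * L ^+ n.+1)); last lra.
  apply: (ler_pM (f0 y) _ (fN y)); first exact: exprn_ge0.
  by rewrite lerXn2r ?nnegrE// ltW.
apply: (@le_trans _ _ (expR m * (n.+1)`!%:R * L ^+ n.+1)); last lra.
set a := `|y j 0 - x0 j 0| in Lw *.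
pose T := a / L; have T1 : 1 < T by rewrite /T ltr_pdivlMr// mul1r.
have T0 : 0 < T by lra.
have aE : a = T * L by rewrite /T divfK// gt_eqF.
(* Otherwise the point at the fraction [1 / T] of the way from [x0] to [y] has level at least
   [exp (m - 1)], although its j-th coordinate is at distance [L > L'] from that of [x0]. *)
have fy : f y <= expR (m - T).
  apply: le_expR_level => q qy; rewrite leNgt; apply/negP => qT.
  have Ti : 0 <= T^-1 <= 1 by rewrite invr_ge0 (ltW T0) invf_le1// ltW.
  have mx0 : expR m <= f x0 by apply: cube => i; rewrite subrr normr0 ltW.
  have := log_concave_expR Ti qy mx0.
  set z := _ *: y + _ => h.
  have : expR (m - 1) <= f z.
    apply: le_trans h; rewrite ler_expR.
    have -> : T^-1 * q + (1 - T^-1) * m = m + T^-1 * (q - m) by ring.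
    rewrite lerD2l; have -> : -1 = T^-1 * (- T) :> R by rewrite mulrN mulVf ?gt_eqF.
    by apply: ler_wpM2l; [rewrite invr_ge0 ltW|lra].
  move/(hL z j); apply/negP; rewrite -ltNge.
  have -> : z j 0 - x0 j 0 = T^-1 * (y j 0 - x0 j 0) by rewrite /z !mxE; ring.
  rewrite normrM ger0_norm ?invr_ge0 ?(ltW T0)// -/a aE mulrA mulVf ?mul1r ?gt_eqF//.
  by rewrite /L; lra.
have T00 : 0 <= T by lra.
have := expR_ge1Dxn n T00 => hT.
have {}hT : T ^+ n.+1 <= (n.+1)`!%:R * expR T.
  have F0 : 0 < (n.+1)`!%:R :> R by rewrite ltr0n fact_gt0.
  by rewrite mulrC -ler_pdivrMr//; lra.
rewrite aE exprMn mulrA; apply: ler_wpM2r; first by rewrite exprn_ge0// ltW.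
apply: (@le_trans _ _ (expR (m - T) * ((n.+1)`!%:R * expR T))).
  by apply: (ler_pM (f0 y) _ fy) => //; rewrite exprn_ge0.
by rewrite mulrCA -expRD subrK mulrC.
Qed.

End log_concave_decay.

(** * John ellipsoids and profile densities *)

Section posdef.
Context {R : realType}.
Variable n : nat.
Implicit Types A : 'M[R]_n.

Lemma posdefmx_det A : posdefmx A -> \det A != 0.
Proof.
move=> [As Ap]; apply/negP => /det0P[v v0 vA].
have vT0 : v^T != 0 by apply: contra v0 => /eqP h; rewrite -[v]trmxK h trmx0.
have := Ap _ vT0; rewrite -{1}As -trmx_mul vA trmx0.
by rewrite /dotp big1 ?ltxx// => i _; rewrite !mxE mulr0.
Qed.

Lemma dotpZr (c : R) (u v : 'cV[R]_n) : dotp u (c *: v) = c * dotp u v.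
Proof. by rewrite /dotp mulr_sumr; apply: eq_bigr => i _; rewrite mxE mulrCA. Qed.

Lemma sqnormZ (c : R) (v : 'cV[R]_n) : sqnorm (c *: v) = c ^+ 2 * sqnorm v.
Proof. by rewrite !sqnormE mulr_sumr; apply: eq_bigr => i _; rewrite mxE exprMn. Qed.

Lemma posdefmxZ (c : R) A : 0 < c -> posdefmx A -> posdefmx (c *: A).
Proof.
move=> c0 [As Ap]; split; first by rewrite linearZ/= As.
by move=> u u0; rewrite -scalemxAl dotpZr mulr_gt0// Ap.
Qed.

Lemma enorm_sqr (v : 'cV[R]_n) : enorm v ^+ 2 = sqnorm v.
Proof. by rewrite /enorm sqr_sqrtr// sqnorm_ge0. Qed.

Lemma enorm_le1 (v : 'cV[R]_n) : (enorm v <= 1) = (sqnorm v <= 1).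
Proof.
rewrite -enorm_sqr; have e0 : 0 <= enorm v by exact: sqrtr_ge0.
by rewrite -[in RHS](expr1n _ 2) ler_pXn2r// nnegrE.
Qed.

End posdef.

Section john_scale.
Context {R : realType}.
Variables (n : nat) (f : 'cV[R]_n -> R).
Hypothesis f0 : forall x, 0 <= f x.
Implicit Types (A : 'M[R]_n) (a x : 'cV[R]_n) (b s : R) (q : R -> R).

Definition profile_below q A b a : Prop :=
  [/\ posdefmx A, 0 < b & forall x, profile_density q A b a x <= f x].

(* With this normalization the s-th power of the height function tends, as s goes
   to infinity, to the Gaussian with parameters A, b, a. *)
Definition john_scale s A b a : ellipsoid_data n :=
  (Num.sqrt (s / 2) *: A, b `^ s^-1, a).

(** [Num.sqrt] is 0 on negative numbers, which reproduces the value 0 outside the ellipsoid. *)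
Lemma ellipsoid_heightE A b a x : \det A != 0 ->
  ellipsoid_height (A, b, a) x = b * Num.sqrt (1 - sqnorm (invmx A *m (x - a))).
Proof.
move=> dA; have uA : A \in unitmx by rewrite unitmxE unitfE.
rewrite /ellipsoid_height; case: ifPn => [_|]; first by rewrite enorm_sqr.
rewrite notin_setE => h; rewrite ler0_sqrtr ?mulr0//.
rewrite subr_le0 leNgt; apply/negP => /ltW su; apply: h.
exists (invmx A *m (x - a)); first by rewrite /unit_ball/= enorm_le1.
by rewrite mulmxA mulmxV// mul1mx subrK.
Qed.

Lemma john_scale_is_ellipsoid s A b a : 0 < s -> posdefmx A -> 0 < b ->
  is_ellipsoid (john_scale s A b a).
Proof.
move=> s0 pA b0; split; last exact: powR_gt0.
by apply: posdefmxZ => //; rewrite sqrtr_gt0 divr_gt0.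
Qed.

Lemma ellipsoid_john_scale s (E : ellipsoid_data n) : 0 < s -> is_ellipsoid E ->
  exists A b a, [/\ posdefmx A, 0 < b & E = john_scale s A b a].
Proof.
move=> s0; case: E => -[A alpha] a [pA al0].
have c0 : 0 < Num.sqrt (s / 2) by rewrite sqrtr_gt0 divr_gt0.
exists ((Num.sqrt (s / 2))^-1 *: A), (alpha `^ s), a; split.
- by apply: posdefmxZ => //; rewrite invr_gt0.
- exact: powR_gt0.
- by rewrite /john_scale scalerA divff ?gt_eqF// scale1r -powRrM divff ?gt_eqF//
  powRr1// ltW.
Qed.

Lemma john_scale_height s A b a x : 0 < s -> posdefmx A -> 0 < b ->
  ellipsoid_height (john_scale s A b a) x `^ s = profile_density (john_profile s) A b a x.
Proof.
move=> s0 pA b0; have c0 : 0 < Num.sqrt (s / 2) by rewrite sqrtr_gt0 divr_gt0.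
rewrite ellipsoid_heightE; last first.
  by rewrite detZ; apply: mulf_neq0; [rewrite expf_neq0 ?gt_eqF|exact: posdefmx_det].
rewrite invmxZ; last first.
  by rewrite unitmxZ ?unitmxE ?unitfE ?posdefmx_det// gt_eqF.
rewrite -scalemxAl sqnormZ exprVn sqr_sqrtr; last by rewrite divr_ge0// ltW.
rewrite powRM ?powR_ge0 ?sqrtr_ge0// -powRrM mulVf ?gt_eqF// powRr1 ?ltW//.
by rewrite /profile_density /john_profile invf_div mulrAC.
Qed.

Lemma svolume_john_scale s A b a : 0 < s -> posdefmx A -> 0 < b ->
  svolume s (john_scale s A b a) = (b * `|\det A| * john_const n s)%:E.
Proof.
move=> s0 pA b0; rewrite /svolume EFinM -radial_integral_john//.
rewrite -(integral_profile a (posdefmx_det pA) (measurable_john_profile s)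
  (@john_profile_ge0 R s) (ltW b0)).
by congr integral_Rn; apply/funext => x; rewrite john_scale_height.
Qed.

(** Over each [x] it suffices to test the top boundary point of the ellipsoid, because the lifting
    contains with a point all those of smaller [|xi|] over the same [x]. *)
Lemma ellipsoid_sub_lifting s (E : ellipsoid_data n) : 0 < s -> is_ellipsoid E ->
  ellipsoid_set E `<=` lifting f s <-> forall x, ellipsoid_height E x `^ s <= f x.
Proof.
move=> s0; case: E => -[A alpha] a [pA al0]; have dA := posdefmx_det pA.
have uA : A \in unitmx by rewrite unitmxE unitfE.
have E (u : 'cV[R]_n) (w : R) : block_mx A 0 0 alpha%:M *m col_mx u w%:M + col_mx a 0 =
    col_mx (A *m u + a) (alpha * w)%:M.
  by rewrite mul_block_col !mul0mx addr0 add0r add_col_mx addr0 -scalar_mxM.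
have sqc (u : 'cV[R]_n) (w : R) : sqnorm (col_mx u w%:M) = sqnorm u + w ^+ 2.
  rewrite !sqnormE big_split_ord/= big_ord1; congr (_ + _).
    by apply: eq_bigr => i _; rewrite col_mxEu.
  by rewrite col_mxEd mxE eqxx mulr1n.
have powK y z : 0 <= y -> 0 <= z -> (y <= z `^ s^-1) = (y `^ s <= z).
  move=> y0 z0; apply/idP/idP => h.
    have := @ge0_ler_powR R s (ltW s0) y (z `^ s^-1) y0 (powR_ge0 _ _) h.
    by rewrite -powRrM mulVf ?gt_eqF// powRr1.
  have si0 : 0 <= s^-1 by rewrite invr_ge0 ltW.
  have := @ge0_ler_powR R s^-1 si0 (y `^ s) z (powR_ge0 _ _) z0 h.
  by rewrite -powRrM divff ?gt_eqF// powRr1.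
have h0 x : 0 <= alpha * Num.sqrt (1 - sqnorm (invmx A *m (x - a))).
  by rewrite mulr_ge0 ?sqrtr_ge0// ltW.
split=> [sub x|h z [w wB <-]].
  rewrite ellipsoid_heightE//; have [su|su] := leP (sqnorm (invmx A *m (x - a))) 1;
    last first.
    by rewrite ler0_sqrtr ?mulr0 ?powR0 ?gt_eqF//; lra.
  rewrite -powK//; set u := invmx A *m (x - a) in su *.
  have xE : A *m u + a = x by rewrite /u mulmxA mulmxV// mul1mx subrK.
  have := sub (col_mx x (alpha * Num.sqrt (1 - sqnorm u))%:M).
  rewrite /lifting/= col_mxKu col_mxKd mxE eqxx mulr1n ger0_norm; last first.
    by rewrite mulr_ge0 ?sqrtr_ge0// ltW.
  apply; exists (col_mx u (Num.sqrt (1 - sqnorm u))%:M); last by rewrite E xE.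
  by rewrite /unit_ball/= enorm_le1 sqc sqr_sqrtr; lra.
rewrite -(vsubmxK w) in wB *; set u := usubmx w in wB *.
rewrite [dsubmx w]mx11_scalar in wB *; set xi := dsubmx w 0 0 in wB *.
rewrite E /lifting/= col_mxKu col_mxKd mxE eqxx mulr1n.
have su : sqnorm u + xi ^+ 2 <= 1 by rewrite -sqc -enorm_le1.
have := h (A *m u + a);
  rewrite ellipsoid_heightE// addrK mulmxA mulVmx// mul1mx -powK//; last first.
  by rewrite mulr_ge0 ?sqrtr_ge0// ltW.
apply: le_trans; rewrite normrM gtr0_norm// ler_pM2l//.
by rewrite -sqrtr_sqr; apply: ler_wsqrtr; lra.
Qed.

Lemma john_scale_sub_lifting s A b a : 0 < s -> posdefmx A -> 0 < b ->
  ellipsoid_set (john_scale s A b a) `<=` lifting f s <-> profile_below (john_profile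
    s) A b a.
Proof.
move=> s0 pA b0; have iE := john_scale_is_ellipsoid a s0 pA b0.
split => [/(ellipsoid_sub_lifting s0 iE) h|[_ _ h]].
  by split => // x; rewrite -john_scale_height.
by apply/(ellipsoid_sub_lifting s0 iE) => x; rewrite john_scale_height.
Qed.

Lemma john_svolume_gt0_below s : 0 < s -> (0 < john_svolume f s)%E ->
  exists A b a, profile_below (john_profile s) A b a.
Proof.
move=> s0; rewrite /john_svolume /john_ellipsoid; case: xgetP => [E _ [iE sub _] _|_].
  have [A [b [a [pA b0 EE]]]] := ellipsoid_john_scale s0 iE.
  by exists A, b, a; apply/john_scale_sub_lifting => //; rewrite -EE.
(* The default value of [xget] has height 0, hence s-volume 0; positivity of the s-volume thus
   certifies that a John ellipsoid exists. *)
rewrite (_ : svolume s _ = 0%E) ?ltxx//; apply: integral0_eq => t _; congr EFin.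
rewrite /ellipsoid_height; case: ifP => _; rewrite ?mul0r powR0 ?gt_eqF//.
Qed.

(** A maximizer of [b |det A|] is a John ellipsoid, so [xget] returns a genuine one; its properties
    are then translated to the normalized parameters. *)
Lemma john_ellipsoid_spec s A0 b0 a0 : 0 < s -> profile_below (john_profile s) A0 b0 a0 ->
  (forall A b a, profile_below (john_profile s) A b a -> b * `|\det A| <= b0 * `|\det
    A0|) ->
  exists A b a, [/\ profile_below (john_profile s) A b a,
    forall A' b' a', profile_below (john_profile s) A' b' a' ->
      ((b' * `|\det A'| * john_const n s)%:E <= john_svolume f s)%E,
    john_svolume f s = (b * `|\det A| * john_const n s)%:E &
    john_function f s = profile_density (john_profile s) A b a].
Proof.
move=> s0 B0 max0.
have isj : is_john_ellipsoid f s (john_scale s A0 b0 a0).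
  have [pA0 b00 _] := B0; split; first exact: john_scale_is_ellipsoid.
    by apply/john_scale_sub_lifting.
  move=> E iE; have [A [b [a [pA b1 ->]]]] := ellipsoid_john_scale s0 iE.
  move/john_scale_sub_lifting => /(_ s0 pA b1) /max0 h.
  by rewrite !svolume_john_scale// lee_fin ler_wpM2r// john_const_ge0.
have [iE sub mx] : is_john_ellipsoid f s (john_ellipsoid f s).
  exact: (@xgetPex _ (0, 0, 0) [set E | is_john_ellipsoid f s E] (ex_intro _ _ isj)).
have [A [b [a [pA b1 EE]]]] := ellipsoid_john_scale s0 iE.
exists A, b, a; split.
- by apply/john_scale_sub_lifting => //; rewrite -EE.
- move=> A' b' a' B'; have [pA' b'0 _] := B'.
  rewrite -(svolume_john_scale a' s0 pA' b'0); apply: mx.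
    exact: john_scale_is_ellipsoid.
  by apply/john_scale_sub_lifting.
- by rewrite /john_svolume EE svolume_john_scale.
- by apply/funext => x; rewrite /john_function EE john_scale_height.
Qed.

End john_scale.

(** * Limits along ultrafilters *)

Section ultrafilter_limits.
Context {R : realType}.
Variables (I : Type) (U : set_system I).

Lemma ultra_fmap (T : Type) (f : I -> T) : UltraFilter U -> UltraFilter (f @ U).
Proof.
move=> UU; apply: Build_UltraFilter => G GP sub; apply/seteqP; split => // B GB.
have [//|nB] := in_ultra_setVsetC (f @^-1` B) UU.
have GnB : G (~` B) by apply: sub; exact: nB.
by exfalso; apply: (@filter_not_empty _ G); rewrite -(setICr B); exact: filterI.
Qed.

(** Compactness of a segment in its ultrafilter form. The same [U] works for every bounded function,
    which replaces the successive extraction of subsequences. *)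
Lemma ultra_bounded_cvg (f : I -> R) (M : R) : UltraFilter U ->
  (\forall i \near U, `|f i| <= M) -> exists l : R, f i @[i --> U] --> l.
Proof.
move=> UU fM; have := @segment_compact R (- M) M; rewrite compact_ultra.
have UfU := ultra_fmap f UU.
move=> /(_ (f @ U) UfU) []; last by move=> l [_ fl]; exists l.
by apply: filterS fM => i /=; rewrite in_itv/= ler_norml.
Qed.

Lemma cvg_sumr (J : Type) (r : seq J) (F : J -> I -> R) (l : J -> R) : Filter U ->
  (forall j, F j i @[i --> U] --> l j) ->
  \sum_(j <- r) F j i @[i --> U] --> \sum_(j <- r) l j.
Proof.
move=> FU Fl; elim: r => [|j r IHr].
  under eq_fun do rewrite big_nil; rewrite big_nil; exact: cvg_cst.
under eq_fun do rewrite big_cons; rewrite big_cons; apply: cvgD => //; exact: Fl.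
Qed.

Lemma cvg_prodr (J : Type) (r : seq J) (F : J -> I -> R) (l : J -> R) : Filter U ->
  (forall j, F j i @[i --> U] --> l j) ->
  \prod_(j <- r) F j i @[i --> U] --> \prod_(j <- r) l j.
Proof.
move=> FU Fl; elim: r => [|j r IHr].
  under eq_fun do rewrite big_nil; rewrite big_nil; exact: cvg_cst.
under eq_fun do rewrite big_cons; rewrite big_cons; apply: cvgM => //; exact: Fl.
Qed.

Definition entrywise_cvg m n (A_ : I -> 'M[R]_(m, n)) (A : 'M[R]_(m, n)) :=
  forall i j, A_ k i j @[k --> U] --> A i j.

Lemma entrywise_cvg_cst m n (A : 'M[R]_(m, n)) : Filter U -> entrywise_cvg (fun=> A) A.
Proof. by move=> FU i j; exact: cvg_cst. Qed.

Lemma entrywise_cvgB m n (A_ B_ : I -> 'M[R]_(m, n)) A B : Filter U ->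
  entrywise_cvg A_ A -> entrywise_cvg B_ B -> entrywise_cvg (fun k =>
    A_ k - B_ k) (A - B).
Proof.
move=> FU hA hB i j; rewrite !mxE; under eq_fun do rewrite !mxE; exact: cvgB.
Qed.

Lemma entrywise_cvgM m n p (A_ : I -> 'M[R]_(m, n)) (B_ : I -> 'M[R]_(n,
  p)) A B : Filter U ->
  entrywise_cvg A_ A -> entrywise_cvg B_ B -> entrywise_cvg (fun k =>
    A_ k *m B_ k) (A *m B).
Proof.
move=> FU hA hB i j; rewrite mxE; under eq_fun do rewrite mxE.
by apply: cvg_sumr => l; exact: cvgM.
Qed.

Lemma cvg_det n (A_ : I -> 'M[R]_n) A : Filter U -> entrywise_cvg A_ A ->
  \det (A_ k) @[k --> U] --> \det A.
Proof.
move=> FU hA; apply: cvg_sumr => s; apply: cvgMl_tmp.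
by apply: cvg_prodr => i; exact: hA.
Qed.

(** By the adjugate formula, the entries of the inverse are cofactors divided by the determinant. *)
Lemma entrywise_cvg_invmx n (A_ : I -> 'M[R]_n) A : Filter U -> entrywise_cvg A_ A ->
  (forall k, \det (A_ k) != 0) -> \det A != 0 ->
  entrywise_cvg (fun k => invmx (A_ k)) (invmx A).
Proof.
move=> FU hA dAk dA i j.
have E (B : 'M[R]_n) : \det B != 0 -> invmx B i j = (\det B)^-1 * cofactor B j i.
  by move=> dB; rewrite /invmx unitmxE unitfE dB !mxE.
rewrite E//; under eq_fun do rewrite E//.
apply: cvgM; first by apply: cvgV => //; exact: cvg_det.
apply: cvgMl_tmp; apply: cvg_det => k l; rewrite !mxE.
by under eq_fun do rewrite !mxE; exact: hA.
Qed.

Lemma cvg_dotp n (u_ v_ : I -> 'cV[R]_n) u v : Filter U -> entrywise_cvg u_ u ->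
  entrywise_cvg v_ v -> dotp (u_ k) (v_ k) @[k --> U] --> dotp u v.
Proof. by move=> FU hu hv; apply: cvg_sumr => i; exact: cvgM. Qed.

Lemma cvg_sqnorm_affine n (A_ : I -> 'M[R]_n) A (a_ x_ : I -> 'cV[R]_n) a x : Filter U ->
  entrywise_cvg A_ A -> (forall k, \det (A_ k) != 0) -> \det A != 0 ->
  entrywise_cvg a_ a -> entrywise_cvg x_ x ->
  sqnorm (invmx (A_ k) *m (x_ k - a_ k)) @[k --> U] --> sqnorm (invmx A *m (x - a)).
Proof.
move=> FU hA dAk dA ha hx.
have h : entrywise_cvg (fun k => invmx (A_ k) *m (x_ k - a_ k)) (invmx A *m (x - a)).
  by apply: entrywise_cvgM; [exact: entrywise_cvg_invmx|exact: entrywise_cvgB].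
exact: cvg_dotp.
Qed.

(** The limit is symmetric and positive semidefinite by closedness; a nonzero [u] with [u A u = 0]
    would lie in the kernel of [A], contrary to [\det A != 0]. *)
Lemma limit_posdefmx n (A_ : I -> 'M[R]_n) A : ProperFilter U -> entrywise_cvg A_ A ->
  (forall k, posdefmx (A_ k)) -> \det A != 0 -> posdefmx A.
Proof.
move=> FU hA pA dA.
have As : A^T = A.
  apply/matrixP => i j; rewrite mxE.
  have h := hA i j.
  have h' : A_ k i j @[k --> U] --> A j i.
    apply: cvg_trans (hA j i); apply: near_eq_cvg; near=> k.
    by have [/matrixP/(_ i j) + _] := pA k; rewrite mxE.
  by rewrite -(cvg_lim _ h')// -(cvg_lim _ h).
have psd u : 0 <= dotp u (A *m u).
  apply: (@cvgr_to_ge _ U _ R (fun k => dotp u (A_ k *m u)) (dotp u (A *m u))).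
    apply: cvg_dotp; first exact: entrywise_cvg_cst.
    by apply: entrywise_cvgM => //; exact: entrywise_cvg_cst.
  near=> k; have [_ pk] := pA k.
  have [->|u0] := eqVneq u 0; last exact/ltW/pk.
  by rewrite mulmx0 /dotp big1// => i _; rewrite !mxE mulr0.
split => // u u0; rewrite lt_def psd andbT; apply/negP => /eqP uAu.
have dotC (x y : 'cV[R]_n) : dotp x y = dotp y x.
  by apply: eq_bigr => i _; rewrite mulrC.
have dotD (x y z : 'cV[R]_n) : dotp x (y + z) = dotp x y + dotp x z.
  by rewrite /dotp -big_split; apply: eq_bigr => i _; rewrite mxE mulrDr.
have dotA (x y : 'cV[R]_n) : dotp x (A *m y) = dotp y (A *m x).
  have E (w z : 'cV[R]_n) : dotp w z = (w^T *m z) 0 0.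
    by rewrite mxE; apply: eq_bigr => i _; rewrite mxE.
  rewrite !E; have -> : y^T *m (A *m x) = (x^T *m (A *m y))^T.
    by rewrite !trmx_mul As trmxK mulmxA.
  by rewrite [RHS]mxE.
(* Cauchy-Schwarz for the semidefinite form, in the shape of [key]: u A u = 0
   forces A u = 0. *)
pose v := A *m u.
have v0 : 0 < dotp v v.
  have : v != 0.
    apply: contra u0 => /eqP v0; have := congr1 (mulmx (invmx A)) v0.
    by rewrite mulmxA mulVmx ?unitmxE ?unitfE// mul1mx mulmx0 => ->.
  move=> vn0; rewrite lt_def -/(sqnorm v) sqnorm_ge0 andbT; apply: contra vn0.
  rewrite sqnormE psumr_eq0 => [|i _]; last exact: sqr_ge0.
  move/allP => h; apply/eqP/matrixP => i j; rewrite [RHS]mxE ord1.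
  by have := h i (mem_index_enum i); rewrite /= sqrf_eq0 => /eqP.
have key t : 0 <= 2 * t * dotp v v + t ^+ 2 * dotp v (A *m v).
  have := psd (u + t *: v).
  rewrite mulmxDr -scalemxAr dotD dotpZr ![dotp (u + _) _]dotC !dotD !dotpZr.
  rewrite [dotp (A *m u) u]dotC uAu add0r [dotp (A *m v) u]dotC (dotA u v).
  rewrite -/v [dotp (A *m v) v]dotC.
  by congr (_ <= _); ring.
pose q := dotp v (A *m v).
have q0 : 0 <= q by exact: psd.
(* A negative [t] small enough for the linear term to win; the [+ 1] covers [q = 0]. *)
have := key (- (dotp v v / (q + 1))); rewrite -/q.
have q1 : 0 < q + 1 by lra.
set p := dotp v v in v0 *.
have -> : 2 * - (p / (q + 1)) * p + (- (p / (q + 1))) ^+ 2 * q = - (p ^+ 2 * (q + 2) /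
  (q + 1) ^+ 2).
  by field; rewrite gt_eqF.
rewrite oppr_ge0 leNgt divr_gt0// ?mulr_gt0 ?exprn_gt0//; lra.
Unshelve. all: by end_near. Qed.

End ultrafilter_limits.

(** * Compactness of the densities below a log-concave function *)

Lemma det_norm_le (R : realType) n (A : 'M[R]_n) (mu : R) :
  (forall i j, `|A i j| <= mu) -> `|\det A| <= n`!%:R * mu ^+ n.
Proof.
move=> h; apply: le_trans (ler_norm_sum _ _ _) _.
apply: (@le_trans _ _ (\sum_(s : {perm 'I_n}) mu ^+ n)); last first.
  by rewrite sumr_const card_Sn mulr_natl.
apply: ler_sum => s _; rewrite normrM normrX normrN1 expr1n mul1r normr_prod.
rewrite -[X in _ <= mu ^+ X]card_ord -prodr_const; apply: ler_prod => i _.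
by rewrite normr_ge0 h.
Qed.

Lemma le_of_exprS_le (R : realType) n (y D : R) : 0 <= y -> y ^+ n.+1 <= D -> y <= D + 1.
Proof.
move=> y0 h; have [y1|y1] := leP y 1.
  by have := le_trans (exprn_ge0 n.+1 y0) h; lra.
apply: le_trans (_ : D <= _); last lra.
by apply: le_trans h; rewrite exprS ler_peMr// exprn_ege1// ltW.
Qed.

Section below_bounds.
Context {R : realType}.
Variables (n : nat) (f : 'cV[R]_n -> R).
Implicit Types (A : 'M[R]_n) (a x : 'cV[R]_n) (b s : R) (q : R -> R).

(* The uniform lower bound near the center that makes the densities below f
   compact. *)
Definition core_profile q := forall t, 0 <= t -> 2 * t <= 1 -> expR (- 1) <= q t.

Lemma core_john_profile s : 2 <= s -> core_profile (john_profile s).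
Proof. by move=> s2 t t0 t1; exact: john_profile_half. Qed.

(** On a small cube around [a] the profile is at least [exp (-1)], so [f >= b exp (-1)] there, and
    the decay of log-concave functions applies with [x0 = a]. *)
Lemma below_decay q A b a : (forall x, 0 <= f x) -> log_concave f ->
  (integral_Rn f < +oo)%E -> core_profile q -> profile_below f q A b a ->
  exists x0 C, 0 <= C /\ forall y, f y <= C /\
    forall j, f y * `|y j 0 - x0 j 0| ^+ n.+1 <= C.
Proof.
move=> f0 lcf intf cq [pA b0 below].
(* [S] dominates all absolute row sums of [invmx A], so the cube of radius [1 / (S k)] is sent to
   coordinates of size at most [1 / k]; then [k^2 >= 2 n] gives [2 * sqnorm <= 1]. *)
pose S := \sum_i \sum_j `|invmx A i j| + 1.
have S0 : 0 < S by apply: ltr_wpDl => //; apply: sumr_ge0 => i _; exact: sumr_ge0.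
pose k : R := 2 * n%:R + 2.
have n0 : 0 <= n%:R :> R by [].
have k0 : 0 < k by rewrite /k; lra.
pose rho := (S * k)^-1.
have rho0 : 0 < rho by rewrite invr_gt0 mulr_gt0.
have cube x : (forall i, `|x i 0 - a i 0| <= rho) -> expR (ln b - 1) <= f x.
  move=> xa; apply: le_trans (below x); rewrite /profile_density expRD lnK ?posrE//.
  apply: ler_wpM2l; first exact: ltW.
  apply: cq; first exact: sqnorm_ge0.
  have coord i : `|(invmx A *m (x - a)) i 0| <= k^-1.
    rewrite mxE; apply: le_trans (ler_norm_sum _ _ _) _.
    apply: (@le_trans _ _ (\sum_j `|invmx A i j| * rho)).
      apply: ler_sum => j _; rewrite normrM; apply: ler_wpM2l => //.
      by rewrite !mxE xa.
    rewrite -mulr_suml; apply: (@le_trans _ _ (S * rho)).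
      apply: ler_wpM2r; first exact: ltW.
      rewrite /S [X in _ <= X + 1](bigD1 i)//= -addrA lerDl addr_ge0//.
      by apply: sumr_ge0 => i' _; exact: sumr_ge0.
    by rewrite /rho invfM mulVKf ?gt_eqF.
  rewrite sqnormE; apply: (@le_trans _ _ (2 * (n%:R * (k^-1) ^+ 2))).
    apply: ler_wpM2l => //.
    apply: (@le_trans _ _ (\sum_(i < n) (k^-1) ^+ 2)); last first.
      by rewrite sumr_const card_ord mulr_natl.
    apply: ler_sum => i _; rewrite -real_normK ?num_real//.
    by rewrite ler_pXn2r ?nnegrE// invr_ge0 ltW.
  rewrite mulrA exprVn ler_pdivrMr ?exprn_gt0// mul1r expr2 /k; nra.
have [C C0 h] := log_concave_decay f0 lcf rho0 cube intf.
by exists a, C.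
Qed.

(** From here on all bounds depend on [f] only through [x0] and [C], hence hold uniformly in the
    profile. The exponent [n.+1] exceeds by one the degree of the determinant in the entries. *)
Variables (x0 : 'cV[R]_n) (C : R).
Hypotheses (C0 : 0 <= C) (decay : forall y, f y <= C /\
    forall j, f y * `|y j 0 - x0 j 0| ^+ n.+1 <= C).

Let D : R := 2 ^+ n.+1 * (C * expR 1).

Let D0 : 0 <= D.
Proof. by rewrite !mulr_ge0 ?exprn_ge0 ?expR_ge0. Qed.

Section one_profile.
Variables (q : R -> R) (A : 'M[R]_n) (b : R) (a : 'cV[R]_n).
Hypotheses (cq : core_profile q) (B : profile_below f q A b a).

Let b0 : 0 < b. Proof. by case: B. Qed.

Let dA : \det A != 0. Proof. by have [pA _ _] := B; exact: posdefmx_det. Qed.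

Lemma below_core (u : 'cV[R]_n) : 2 * sqnorm u <= 1 -> b <= f (a + A *m u) * expR 1.
Proof.
move=> u1; have [_ _ below] := B.
have -> : b = b * expR (- 1) * expR 1 by rewrite -mulrA -expRD addNr expR0 mulr1.
apply: ler_wpM2r; first exact: expR_ge0.
apply: le_trans (below _); rewrite /profile_density [a + _]addrC addrK.
rewrite mulmxA mulVmx ?unitmxE ?unitfE// mul1mx.
by apply: ler_wpM2l; [exact: ltW|apply: cq => //; exact: sqnorm_ge0].
Qed.

Lemma below_height_le : b <= C * expR 1.
Proof.
apply: le_trans (below_core (u := 0) _) _.
  by rewrite sqnormE big1 ?mulr0// => i _; rewrite mxE expr0n.
by apply: ler_wpM2r; [exact: expR_ge0|exact: (decay _).1].
Qed.

Lemma below_dist_le (u : 'cV[R]_n) i : 2 * sqnorm u <= 1 ->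
  b * `|(a + A *m u) i 0 - x0 i 0| ^+ n.+1 <= C * expR 1.
Proof.
move=> u1; apply: (@le_trans _ _ (f (a + A *m u) * expR 1 * `|(a + A *m u) i 0 - x0 i
  0| ^+ n.+1)).
  by apply: ler_wpM2r; [exact: exprn_ge0|exact: below_core].
rewrite mulrAC; apply: ler_wpM2r; first exact: expR_ge0.
exact: (decay _).2.
Qed.

(* One of the two points a +- A e_j / 2 has its i-th coordinate at distance at
   least |A i j| / 2 from that of x0. *)
Lemma below_entry_le i j : b * `|A i j| ^+ n.+1 <= D.
Proof.
pose u (e : R) : 'cV[R]_n := e *: delta_mx j 0.
have su e : e ^+ 2 = 4^-1 -> 2 * sqnorm (u e) <= 1.
  move=> e2; rewrite sqnormZ e2 sqnormE (bigD1 j)//= big1 => [|k kj].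
    by rewrite mxE !eqxx expr1n addr0; lra.
  by rewrite mxE (negbTE kj) expr0n.
have uE e : (a + A *m u e) i 0 - x0 i 0 = (a i 0 - x0 i 0) + e * A i j.
  by rewrite /u -scalemxAr -colE !mxE; ring.
have p2 : 2^-1 ^+ 2 = 4^-1 :> R by field.
have m2 : (- 2^-1) ^+ 2 = 4^-1 :> R by field.
have := below_dist_le i (su _ p2); have := below_dist_le i (su _ m2).
rewrite !uE; set z := a i 0 - x0 i 0.
have key y : `|A i j| <= 2 * `|y| -> b * `|y| ^+ n.+1 <= C * expR 1 -> b * `|A i j| ^+
  n.+1 <= D.
  move=> h1 h2; apply: (@le_trans _ _ (2 ^+ n.+1 * (b * `|y| ^+ n.+1))).
    rewrite mulrCA -exprMn; apply: ler_wpM2l; first exact: ltW.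
    by apply: lerXn2r; rewrite ?nnegrE// mulr_ge0.
  by apply: ler_wpM2l => //; exact: exprn_ge0.
move=> hm hp; have [h|h] := leP (`|A i j|) (2 * `|z + 2^-1 * A i j|).
  exact: key h hp.
apply: key hm.
have : `|A i j| <= `|z + 2^-1 * A i j| + `|z + - 2^-1 * A i j|.
  have {1}-> : A i j = (z + 2^-1 * A i j) - (z + - 2^-1 * A i j) by field.
  exact: ler_normB.
lra.
Qed.

Lemma below_entries : exists mu,
  [/\ 0 <= mu, b * mu ^+ n.+1 = D & forall i j, `|A i j| <= mu].
Proof.
have Db0 : 0 <= D / b by rewrite divr_ge0// ltW.
(* The size allowed by [below_entry_le], taken with equality so that [b * mu ^+ n.+1] can be
   replaced by [D]. *)
pose mu := (D / b) `^ (n.+1%:R^-1).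
have mu0 : 0 <= mu by exact: powR_ge0.
have muE : mu ^+ n.+1 = D / b.
  by rewrite -powR_mulrn// -powRrM mulVf ?powRr1// pnatr_eq0.
exists mu; split => // [|i j]; first by rewrite muE mulrC divfK// gt_eqF.
have := below_entry_le i j.
rewrite mulrC -ler_pdivlMr// -muE => h.
by rewrite -(@ler_pXn2r _ n.+1) ?nnegrE.
Qed.

(** [b |det A|] is at most [n! b mu^n], and [b mu^n] is at most [b] or [b mu^(n+1)] according to
    whether [mu <= 1]; both are bounded. *)
Lemma below_volume_le : b * `|\det A| <= n`!%:R * (C * expR 1 + D).
Proof.
have [mu [mu0 muD hA]] := below_entries.
apply: (@le_trans _ _ (n`!%:R * (b * mu ^+ n))).
  by rewrite mulrCA; apply: ler_wpM2l; [exact: ltW|exact: det_norm_le].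
apply: ler_wpM2l => //; rewrite -muD.
have [m1|m1] := leP mu 1.
  apply: (@le_trans _ _ (b * 1)).
    by apply: ler_wpM2l; [exact: ltW|exact: exprn_ile1].
  rewrite mulr1; have := below_height_le; have : 0 <= b * mu ^+ n.+1 by rewrite muD.
  lra.
apply: (@le_trans _ _ (b * mu ^+ n.+1)).
  apply: ler_wpM2l; first exact: ltW.
  by rewrite exprS ler_peMl ?exprn_ge0// ltW.
have : 0 <= C * expR 1 by rewrite mulr_ge0// expR_ge0.
lra.
Qed.

Variable c : R.
Hypotheses (c0 : 0 < c) (cA : c <= b * `|\det A|).

Let M : R := n`!%:R * D / c.
Let b1 : R := c / (n`!%:R * (M + 1) ^+ n).

Let M0 : 0 <= M.
Proof. by rewrite /M divr_ge0 ?(ltW c0)// mulr_ge0. Qed.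

(** Multiplying [c <= b |det A| <= n! b mu^n] by [mu] gives [c mu <= n! D]. *)
Lemma below_entry_bound i j : `|A i j| <= M.
Proof.
have [mu [mu0 muD hA]] := below_entries; apply: le_trans (hA i j) _.
rewrite /M ler_pdivlMr// -muD.
apply: (@le_trans _ _ (mu * (b * (n`!%:R * mu ^+ n)))).
  apply: ler_wpM2l => //; apply: le_trans cA _.
  by apply: ler_wpM2l; [exact: ltW|exact: det_norm_le].
by rewrite le_eqVlt; apply/orP; left; apply/eqP; rewrite exprS; ring.
Qed.

Let b10 : 0 < b1.
Proof.
rewrite /b1 divr_gt0// mulr_gt0 ?ltr0n ?fact_gt0//.
by apply: exprn_gt0; apply: ltr_wpDl.
Qed.

Lemma below_height_ge : b1 <= b.
Proof.
rewrite /b1 ler_pdivrMr; last first.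
  by rewrite mulr_gt0 ?ltr0n ?fact_gt0//; apply: exprn_gt0; apply: ltr_wpDl.
apply: le_trans cA _; apply: ler_wpM2l; first exact: ltW.
apply: det_norm_le => i j; apply: le_trans (below_entry_bound i j) _; lra.
Qed.

Lemma below_center_bound i : `|a i 0| <= `|x0 i 0| + (C * expR 1 / b1 + 1).
Proof.
have u0 : 2 * sqnorm (0 : 'cV[R]_n) <= 1.
  by rewrite sqnormE big1 ?mulr0// => k _; rewrite mxE expr0n.
have := below_dist_le i u0; rewrite mulmx0 addr0 => h.
have {}h : `|a i 0 - x0 i 0| ^+ n.+1 <= C * expR 1 / b1.
  rewrite ler_pdivlMr// mulrC; apply: le_trans h.
  by apply: ler_wpM2r; [exact: exprn_ge0|exact: below_height_ge].
have {}h := le_of_exprS_le (normr_ge0 _) h.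
rewrite -[a i 0](subrK (x0 i 0)) addrC; apply: le_trans (ler_normD _ _) _.
by rewrite lerD2l.
Qed.

End one_profile.

(** The profile may vary with [k], as it does when [s] tends to infinity. In the limit
    [c <= b |det A|] survives and excludes both [b = 0] and a singular [A]. *)
Lemma below_ultra_limit (I : Type) (U : set_system I) (q_ : I -> R -> R) (A_ : I ->
  'M[R]_n)
    (b_ : I -> R) (a_ : I -> 'cV[R]_n) (c : R) : UltraFilter U -> 0 < c ->
  (forall k, core_profile (q_ k)) -> (forall k,
    profile_below f (q_ k) (A_ k) (b_ k) (a_ k)) ->
  (forall k, c <= b_ k * `|\det (A_ k)|) ->
  exists A (b : R) a, [/\ entrywise_cvg U A_ A, b_ k @[k --> U] --> b,
    entrywise_cvg U a_ a,
    posdefmx A & 0 < b].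
Proof.
move=> UU c0 cq B cA; have PU : ProperFilter U by exact: (@ultra_proper _ _ UU).
have choiceA i j : exists l : R, A_ k i j @[k --> U] --> l.
  apply: (@ultra_bounded_cvg R I U (fun k => A_ k i j) (n`!%:R * D / c) UU);
    apply: nearW => k.
  exact: (below_entry_bound (cq k) (B k) c0 (cA k)).
have choiceA' i : exists l : 'I_n -> R, forall j, A_ k i j @[k --> U] --> l j.
  by have [l hl] := choice (choiceA i); exists l.
have [AA hA] := choice choiceA'.
have [b hb] : exists b : R, b_ k @[k --> U] --> b.
  apply: (@ultra_bounded_cvg R I U b_ (C * expR 1) UU); apply: nearW => k.
  have [_ b0 _] := B k; rewrite gtr0_norm//; exact: (below_height_le (cq k) (B k)).
have choicea i : exists l : R, a_ k i 0 @[k --> U] --> l.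
  apply: (@ultra_bounded_cvg R I U (fun k => a_ k i 0) _ UU); apply: nearW => k.
  exact: (below_center_bound (cq k) (B k) c0 (cA k)).
have [aa ha] := choice choicea.
pose A := \matrix_(i, j) AA i j; pose a : 'cV[R]_n := \col_i aa i.
have hA' : entrywise_cvg U A_ A by move=> i j; rewrite mxE; exact: hA.
have hdet : b_ k * `|\det (A_ k)| @[k --> U] --> b * `|\det A|.
  apply: cvgM => //; apply: cvg_norm; exact: cvg_det.
have cb : c <= b * `|\det A| by apply: (cvgr_to_ge hdet); exact: nearW.
have dA : \det A != 0.
  by apply/negP => /eqP dA0; move: cb; rewrite dA0 normr0 mulr0 leNgt c0.
have b0 : 0 < b.
  have nd : 0 < `|\det A| by rewrite normr_gt0.
  by have := lt_le_trans c0 cb; rewrite pmulr_lgt0.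
exists A, b, a; split => //.
- by move=> i j; rewrite mxE ord1; exact: ha.
- by apply: (limit_posdefmx PU hA') => // k; have [pA _ _] := B k.
Qed.

End below_bounds.

(** * Existence of John ellipsoids *)

Section john_existence.
Context {R : realType}.
Variable n : nat.

(** The hypothesis on [q_] is continuous convergence, since the arguments of the profiles move with
    [k]. The points [x_] move too, for the sake of the uniform convergence in [john_ultra_limit]. *)
Lemma cvg_profile_density (I : Type) (U : set_system I) (q_ : I -> R -> R) (q : R -> R)
    (A_ : I -> 'M[R]_n) (b_ : I -> R) (a_ x_ : I -> 'cV[R]_n) A b a x : Filter U ->
  (forall (T_ : I -> R) t, (forall k, 0 <= T_ k) -> T_ k @[k --> U] --> t ->
    q_ k (T_ k) @[k --> U] --> q t) ->
  (forall k, posdefmx (A_ k)) -> posdefmx A ->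
  entrywise_cvg U A_ A -> b_ k @[k --> U] --> b -> entrywise_cvg U a_ a ->
  entrywise_cvg U x_ x ->
  profile_density (q_ k) (A_ k) (b_ k) (a_ k) (x_ k) @[k --> U] --> profile_density q A
    b a x.
Proof.
move=> FU hq pA_ pA hA hb ha hx; apply: cvgM => //; apply: hq => [k|];
  first exact: sqnorm_ge0.
by apply: cvg_sqnorm_affine => // [k|]; exact: posdefmx_det.
Qed.

Variable f : 'cV[R]_n -> R.
Hypotheses (f0 : forall x,
  0 <= f x) (lcf : log_concave f) (intf : (integral_Rn f < +oo)%E).

Lemma john_maximizer s A0 b0 a0 : 2 <= s -> profile_below f (john_profile s) A0 b0 a0 ->
  exists A b a, profile_below f (john_profile s) A b a /\
    forall A' b' a', profile_below f (john_profile s) A' b' a' -> b' * `|\det A'| <= b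
      * `|\det A|.
Proof.
move=> s2 B0; have cq := core_john_profile s2.
have [x0 [C [C0 decay]]] := below_decay f0 lcf intf cq B0.
pose V := [set v : R | exists A b a, profile_below f (john_profile s) A b a /\ v = b *
  `|\det A|].
pose v0 := b0 * `|\det A0|.
have Vv0 : V v0 by exists A0, b0, a0.
have v00 : 0 < v0.
  by have [pA b00 _] := B0; rewrite mulr_gt0// normr_gt0 posdefmx_det.
have supV : has_sup V.
  split; first by exists v0.
  exists (n`!%:R * (C * expR 1 + 2 ^+ n.+1 * (C * expR 1))) => _ [A [b [a [B ->]]]].
  exact: (below_volume_le C0 decay cq B).
(* A maximizing sequence whose terms of volume below [v0] are replaced by the given one, so that the
   positive lower bound [v0] holds for every index. *)
have ex k : exists E : 'M[R]_n * R * 'cV[R]_n,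
    [/\ profile_below f (john_profile s) E.1.1 E.1.2 E.2,
      v0 <= E.1.2 * `|\det E.1.1| & sup V - k.+1%:R^-1 <= E.1.2 * `|\det E.1.1|].
  have e0 : 0 < k.+1%:R^-1 :> R by rewrite invr_gt0 ltr0n.
  have [_ [A [b [a [B ->]]]] h] := sup_adherent e0 supV.
  have [vv|vv] := leP v0 (b * `|\det A|); first by exists (A, b, a); split => //;
    exact: ltW.
  exists (A0, b0, a0); split; [exact: B0|exact: lexx|].
  exact: ltW (lt_trans h vv).
have [E hE] := choice ex.
have [U [UU sU]] := ultraFilterLemma (F := \oo) _.
have PU : ProperFilter U by exact: (@ultra_proper _ _ UU).
have BE k : profile_below f (john_profile s) (E k).1.1 (E k).1.2 (E k).2 by have [] :=
  hE k.
have [A [b [a [hA hb ha pA b1]]]] := below_ultra_limit C0 decay UU v00 (fun=> cq) BE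
  (fun k => let: And3 _ h _ := hE k in h).
exists A, b, a; split.
  split => // x.
  have h : profile_density (john_profile s) (E k).1.1 (E k).1.2 (E k).2 x @[k --> U] -->
      profile_density (john_profile s) A b a x.
    apply: (cvg_profile_density (x_ := fun=> x)) => // [T_ t _|k|].
    - by apply: cvg_john_profile; lra.
    - by have [] := BE k.
    - exact: entrywise_cvg_cst.
  by apply: (cvgr_to_le h); apply: nearW => k; have [_ _] := BE k; exact.
move=> A' b' a' B'; apply: (@le_trans _ _ (sup V)).
  by apply: sup_upper_bound => //; exists A', b', a'.
have hdet : (E k).1.2 * `|\det (E k).1.1| + k.+1%:R^-1 @[k --> U] --> b * `|\det A| + 0.
  apply: cvgD; first by apply: cvgM => //; apply: cvg_norm; exact: cvg_det.
  by apply: cvg_trans (@cvg_harmonic R) => P hP; exact: sU.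
rewrite -[leRHS]addr0; apply: (cvgr_to_ge hdet); apply: nearW => k.
by have [_ _ h] := hE k; rewrite -lerBlDr.
Qed.

End john_existence.

(** * The limit of the John functions *)

Lemma cvg_limf_esup (T : choiceType) (X : filteredType T) (R : realType)
    (h : X -> \bar R) (F : set_system X) (l : R) : ProperFilter F ->
  h x @[x --> F] --> l%:E -> limf_esup h F = l%:E.
Proof.
move=> FF /fine_cvgP[hfin hl]; apply/eqP; rewrite eq_le; apply/andP; split.
  apply/lee_addgt0Pr => e e0.
  have V : F [set x | (h x <= l%:E + e%:E)%E].
    have hle : \forall x \near F, fine (h x) <= l + e.
      by apply: (cvgr_le _ hl); rewrite ltrDl.
    near=> x; rewrite /= -EFinD -[h x]fineK; last by near: x.
    by rewrite lee_fin; near: x.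
  apply: (@le_trans _ _ (ereal_sup (h @` [set x | (h x <= l%:E + e%:E)%E]))).
    by apply: ereal_inf_lbound; exists [set x | (h x <= l%:E + e%:E)%E].
  by apply: ge_ereal_sup => _ [x hx <-].
apply: le_ereal_inf_tmp => _ [V FV <-]; apply/lee_subgt0Pr => e e0.
have hge : \forall x \near F, l - e <= fine (h x).
  by apply: (cvgr_ge _ hl); rewrite ltrBlDr ltrDl.
have [x [Vx hx]] : exists x, V x /\ (l%:E - e%:E <= h x)%E.
  near F => x; exists x; split; first by near: x.
  rewrite -EFinB -[h x]fineK; last by near: x.
  by rewrite lee_fin; near: x.
by apply: le_trans hx _; apply: ereal_sup_ubound; exists x.
Unshelve. all: by end_near. Qed.

(** If [D] holds frequently along [F], the restriction of [F] to [D] plays the role of a subsequence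
    on which [D] holds. *)
Lemma within_proper_or_near (T : Type) (F : set_system T) (D : set T) : ProperFilter F ->
  (\forall x \near F, ~ D x) \/ ProperFilter (within D F).
Proof.
move=> FF; have [h|h] := pselect (F (~` D)); [by left|right].
by split; [move=> w0; apply: h; apply: filterS w0 => x; apply|exact: within_filter].
Qed.

Section john_limit.
Context {R : realType}.
Variables (n : nat) (f : 'cV[R]_n -> R).
Hypotheses (f0 : forall x,
  0 <= f x) (lcf : log_concave f) (intf : (integral_Rn f < +oo)%E).
Implicit Types (A : 'M[R]_n) (b : R) (a : 'cV[R]_n).

Local Notation gauss_below := (profile_below f gauss_profile).
Local Notation john_below s := (profile_below f (john_profile s)).
Local Notation gc := (@gauss_const R n).

Lemma gaussian_density_belowP g : gaussian_density_below f g <->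
  exists A b a, gauss_below A b a /\ g = profile_density gauss_profile A b a.
Proof.
split=> [[[b [A [a [pA b0 ->]]]] below]|[A [b [a [[pA b0 below] ->]]]]].
  by exists A, b, a.
by split => //; exists b, A, a.
Qed.

Lemma integral_gauss_profile A b a : posdefmx A -> 0 < b ->
  integral_Rn (profile_density gauss_profile A b a) = (b * `|\det A| * gc)%:E.
Proof.
move=> pA b0; rewrite integral_profile ?ltW//; last 3 first.
- exact: posdefmx_det.
- exact: measurable_gauss_profile.
- by move=> t; exact: expR_ge0.
by rewrite radial_integral_gauss_profile -EFinM.
Qed.

Lemma gauss_below_john s A b a : 0 < s -> gauss_below A b a -> john_below s A b a.
Proof.
move=> s0 [pA b0 below]; split => // x; apply: le_trans (below x).
by apply: ler_wpM2l; [exact: ltW|exact: john_profile_le_gauss].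
Qed.

Definition john_spec s (E : 'M[R]_n * R * 'cV[R]_n) : Prop :=
  [/\ john_below s E.1.1 E.1.2 E.2,
    forall A b a, john_below s A b a ->
      ((b * `|\det A| * john_const n s)%:E <= john_svolume f s)%E,
    john_svolume f s = (E.1.2 * `|\det E.1.1| * john_const n s)%:E &
    john_function f s = profile_density (john_profile s) E.1.1 E.1.2 E.2].

Lemma ex_john_spec s A b a : 2 <= s -> john_below s A b a -> exists E, john_spec s E.
Proof.
move=> s2 B; have s0 : 0 < s by lra.
have [A0 [b0 [a0 [B0 mx]]]] := john_maximizer f0 lcf intf s2 B.
have [A1 [b1 [a1 [h1 h2 h3 h4]]]] := john_ellipsoid_spec f0 s0 B0 mx.
by exists (A1, b1, a1).
Qed.

(** The parameters of the Gaussian are themselves admissible for every [s], with s-volume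
    [b |det A| K_s] tending to the integral of the Gaussian. So the lower limit of the s-volumes is
    at least that integral. *)
Lemma near_lt_john_svolume A b a (v : R) : gauss_below A b a ->
  v < b * `|\det A| * gc -> \forall s \near +oo, (v%:E < john_svolume f s)%E.
Proof.
move=> B vlt.
have h : b * `|\det A| * john_const n s @[s --> +oo] --> b * `|\det A| * gc.
  by apply: cvgMl_tmp; exact: cvg_john_const.
near=> s; have s2 : 2 <= s by near: s; apply: nbhs_pinfty_ge; rewrite num_real.
have s0 : 0 < s by lra.
have Bs := gauss_below_john s0 B; have [E [_ mx _ _]] := ex_john_spec s2 Bs.
apply: lt_le_trans (mx _ _ _ Bs); rewrite lte_fin.
by near: s; exact: (cvgr_gt _ h).
Unshelve. all: by end_near. Qed.

Lemma cvg_gauss_profile I (U : set_system I) (T_ : I -> R) t : Filter U ->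
  T_ k @[k --> U] --> t -> gauss_profile (T_ k) @[k --> U] --> gauss_profile t.
Proof.
move=> FU h; have hN : - T_ k @[k --> U] --> - t by exact: cvgN.
exact: (cvg_comp _ _ hN (@continuous_expR R _)).
Qed.

Lemma cvg_john_gauss_profile I (U : set_system I) (s_ T_ : I -> R) t : Filter U ->
  (forall k, 2 <= s_ k) -> s_ k @[k --> U] --> +oo -> (forall k, 0 <= T_ k) ->
  T_ k @[k --> U] --> t ->
  john_profile (s_ k) (T_ k) @[k --> U] --> gauss_profile t.
Proof.
move=> FU s2 soo T0 Tt.
have h0 : 64 / s_ k @[k --> U] --> (0 : R).
  rewrite -[X in _ --> X](mulr0 64); apply: cvgMl_tmp; apply/gtr0_cvgV0 => //.
  by apply: nearW => k; have := s2 k; lra.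
have hd : john_profile (s_ k) (T_ k) - gauss_profile (T_ k) @[k --> U] --> (0 : R).
  have hb : \forall k \near U,
    0 <= `|john_profile (s_ k) (T_ k) - gauss_profile (T_ k)| <= 64 / s_ k.
    by apply: nearW => k; rewrite normr_ge0 john_profile_dist_gauss.
  have hc : (fun=> 0 : R) k @[k --> U] --> (0 : R) by exact: cvg_cst.
  by apply/norm_cvg0P; exact: (squeeze_cvgr hb hc h0).
have h := cvgD hd (cvg_gauss_profile FU Tt); rewrite add0r in h.
rewrite (_ : (fun k => _) = fun k => (john_profile (s_ k) (T_ k) - gauss_profile (T_ k))
  + gauss_profile (T_ k)); first exact: h.
by apply/funext => k; rewrite subrK.
Qed.

(** [F] is a variable because the lemma is applied both to [+oo] and to its restrictions to sets of
    parameters with large s-volume. *)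
Lemma john_ultra_limit (F : set_system R) (c : R) : ProperFilter F ->
  (forall M, F [set s | M <= s]) -> 0 < c ->
  F [set s | (c%:E <= john_svolume f s)%E] ->
  exists U A b a, [/\ UltraFilter U, F `<=` U, gauss_below A b a,
    fine (john_svolume f s) @[s --> U] --> b * `|\det A| * gc &
    forall e, 0 < e -> U [set s | forall x,
      `|john_function f s x - profile_density gauss_profile A b a x| <= e]].
Proof.
move=> FF Foo c0 Fc.
pose good s := 2 <= s /\ (c%:E <= john_svolume f s)%E.
have Fgood : F good by apply: filterI => //; exact: Foo.
have spec s : good s -> exists E, john_spec s E.
  move=> [s2 cs]; have s0 : 0 < s by lra.
  have jv0 : (0 < john_svolume f s)%E by apply: lt_le_trans cs; rewrite lte_fin.
  have [A [b [a B]]] := john_svolume_gt0_below f0 s0 jv0.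
  exact: ex_john_spec s2 B.
have [s1 gs1] := filter_ex Fgood.
(* Parameters that are not [good] receive the data of the fixed good [s1], so that all estimates
   hold for every index while [s_ k = k] on a set of [U]. *)
have ex s : exists p : R * ('M[R]_n * R * 'cV[R]_n),
    [/\ good p.1, good s -> p.1 = s & john_spec p.1 p.2].
  have [gs|ngs] := pselect (good s).
    by have [E hE] := spec s gs; exists (s, E).
  have [E hE] := spec s1 gs1; exists (s1, E).
  by split; [exact: gs1|move=> gs; case: ngs|exact: hE].
have [p hp] := choice ex.
pose s_ k := (p k).1; pose A_ k := (p k).2.1.1; pose b_ k := (p k).2.1.2;
  pose a_ k := (p k).2.2.
have s2 k : 2 <= s_ k by have [[]] := hp k.
have B_ k : john_below (s_ k) (A_ k) (b_ k) (a_ k) by have [_ _ []] := hp k.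
have [U [UU sU]] := ultraFilterLemma FF.
have PU : ProperFilter U by exact: (@ultra_proper _ _ UU).
have Ugood : U [set k | s_ k = k].
  by apply: sU; apply: filterS Fgood => k gk; have [_ /(_ gk)] := hp k.
have soo : s_ k @[k --> U] --> +oo.
  apply/cvgryPge => M; near=> k; have -> : s_ k = k by near: k.
  by near: k; exact/sU/Foo.
have g0 : 0 < gc := gauss_const_gt0 n.
have cq k : core_profile (john_profile (s_ k)) by exact: core_john_profile.
(* Uses [john_const s <= gauss_const] to turn the bound on s-volumes into one that is free of
   [s]. *)
have vol k : c / gc <= b_ k * `|\det (A_ k)|.
  have [[_ ck] _ [[pA b0 _] _ jE _]] := hp k.
  have s0 : 0 < s_ k by have := s2 k; lra.
  move: ck; rewrite jE lee_fin ler_pdivrMr// => h; apply: le_trans h _.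
  by apply: ler_wpM2l; [rewrite mulr_ge0// ltW|exact: john_const_le].
have [x0 [C [C0 decay]]] := below_decay f0 lcf intf (cq 0) (B_ 0).
have cgc : 0 < c / gc by rewrite divr_gt0.
have [A [b [a [hA hb ha pA b0]]]] := below_ultra_limit C0 decay UU cgc cq B_ vol.
have pA_ k : posdefmx (A_ k) by have [] := B_ k.
have hq (T_ : R -> R) t : (forall k, 0 <= T_ k) -> T_ k @[k --> U] --> t ->
    john_profile (s_ k) (T_ k) @[k --> U] --> gauss_profile t.
  exact: cvg_john_gauss_profile.
have below x : profile_density gauss_profile A b a x <= f x.
  have h := cvg_profile_density (q_ := fun k =>
    john_profile (s_ k)) PU hq pA_ pA hA hb ha (@entrywise_cvg_cst R R U n 1 x PU).
  by apply: (cvgr_to_le h); apply: nearW => k; have [_ _] := B_ k; exact.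
exists U, A, b, a; split => //.
  have h : b_ k * `|\det (A_ k)| * john_const n (s_ k) @[k --> U] --> b * `|\det A| * gc.
    apply: cvgM; first by apply: cvgM => //; apply: cvg_norm; exact: cvg_det.
    exact: (cvg_comp _ _ soo (@cvg_john_const R n)).
  apply: cvg_trans h; apply: near_eq_cvg; near=> k.
  have sk : s_ k = k by near: k.
  by have [_ _ [_ _ jE _]] := hp k; rewrite -[in RHS]sk jE.
(* If the convergence were not uniform, the points x_ k where it fails would stay
   bounded, by the decay of f; but along convergent points both densities have the
   same limit. *)
move=> e e0; set S := [set s | _].
have [//|US] := in_ultra_setVsetC S UU; exfalso.
have exx s : exists x, (~` S) s ->
    e < `|john_function f s x - profile_density gauss_profile A b a x|.
  have [Ss|nSs] := pselect (S s); first by exists 0.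
  by move/existsNP: (nSs) => [x /negP]; rewrite -ltNge => h; exists x.
have [x_ hx_] := choice exx.
pose d k := profile_density (john_profile (s_ k)) (A_ k) (b_ k) (a_ k) (x_ k)
  - profile_density gauss_profile A b a (x_ k).
have Ud : U [set k | e <= `|d k|].
  near=> k; have sk : s_ k = k by near: k.
  have /hx_ : (~` S) k by near: k.
  by have [_ _ [_ _ _ jE]] := hp k; rewrite -[in john_function _ _]sk jE => /ltW.
have fx k : `|d k| <= f (x_ k).
  have [_ bk0 Bk] := B_ k.
  have h1 := Bk (x_ k); have h2 := below (x_ k).
  have h3 : 0 <= profile_density (john_profile (s_ k)) (A_ k) (b_ k) (a_ k) (x_ k).
    by rewrite /profile_density mulr_ge0 ?john_profile_ge0// ltW.
  have h4 : 0 <= profile_density gauss_profile A b a (x_ k).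
    by rewrite /profile_density mulr_ge0 ?expR_ge0// ltW.
  by rewrite ler_norml /d; apply/andP; split; lra.
have xcvg i : exists l : R, x_ k i 0 @[k --> U] --> l.
  apply: (@ultra_bounded_cvg R R U (fun k => x_ k i 0) (`|x0 i 0| + (C / e + 1)) UU).
  apply: filterS Ud => k /= ek.
  have ef := le_trans ek (fx k).
  have : `|x_ k i 0 - x0 i 0| ^+ n.+1 <= C / e.
    rewrite ler_pdivlMr// mulrC; apply: le_trans ((decay (x_ k)).2 i).
    by apply: ler_wpM2r => //; exact: exprn_ge0.
  move/(le_of_exprS_le (normr_ge0 _)) => h.
  rewrite -[x_ k i 0](subrK (x0 i 0)) addrC; apply: le_trans (ler_normD _ _) _.
  by rewrite lerD2l.
have [xx hxx] := choice xcvg.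
have hx : entrywise_cvg U x_ (\col_i xx i) by move=> i j; rewrite mxE ord1; exact: hxx.
have h1 := cvg_profile_density (q_ := fun k =>
  john_profile (s_ k)) PU hq pA_ pA hA hb ha hx.
have h2 : profile_density gauss_profile A b a (x_ k) @[k --> U] -->
    profile_density gauss_profile A b a (\col_i xx i).
  apply: (cvg_profile_density (A_ := fun=> A) (b_ := fun=> b) (a_ := fun=> a)) => //.
  - by move=> T_ t _; exact: cvg_gauss_profile.
  - exact: entrywise_cvg_cst.
  - exact: cvg_cst.
  - exact: entrywise_cvg_cst.
have hd : `|d k| @[k --> U] --> (0 : R).
  by apply/norm_cvg0P;
    rewrite -(subrr (profile_density gauss_profile A b a (\col_i xx i))); exact: cvgB.
have : e <= 0 by exact: (cvgr_to_ge hd Ud).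
by rewrite leNgt e0.
Unshelve. all: by end_near. Qed.

End john_limit.

(** * Limit of the s-volumes, maximality and the height bound *)

Section john_limit_consequences.
Context {R : realType}.
Variables (n : nat) (f : 'cV[R]_n -> R).
Hypotheses (f0 : forall x,
  0 <= f x) (lcf : log_concave f) (intf : (integral_Rn f < +oo)%E).
Implicit Types (A : 'M[R]_n) (b : R) (a : 'cV[R]_n).

Local Notation gauss_below := (profile_below f gauss_profile).
Local Notation gc := (@gauss_const R n).

Lemma volume_gt0 q A b a : profile_below f q A b a -> 0 < b * `|\det A|.
Proof. by move=> [pA b0 _]; rewrite mulr_gt0// normr_gt0 posdefmx_det. Qed.

Lemma pinfty_ge (M : R) : (+oo : set_system R) [set s | M <= s].
Proof. by apply: nbhs_pinfty_ge; rewrite num_real. Qed.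

Lemma limf_esup_gt0_gauss_below : (0 < limf_esup (john_svolume f) (+oo)%R)%E ->
  exists A b a, gauss_below A b a.
Proof.
move=> L0.
have [c c0 cL] : exists2 c : R, 0 < c & (c%:E < limf_esup (john_svolume f) (+oo)%R)%E.
  case: (limf_esup _ _) L0 => [l| |]// l0; last by exists 1; rewrite ?ltry.
  by exists (l / 2); rewrite ?lte_fin; move: l0; rewrite lte_fin; lra.
pose D := [set s | (c%:E <= john_svolume f s)%E].
(* If the s-volumes were eventually below [c], so would be their upper limit, up to equality; hence
   the restriction of [+oo] to [D] is proper and yields a limit Gaussian. *)
have [nD|PF] := @within_proper_or_near R (+oo)%R D (proper_pinfty_nbhs).
  exfalso; move: cL; rewrite ltNge => /negP; apply.
  apply: (@le_trans _ _ (ereal_sup (john_svolume f @` [set s | ~ D s]))).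
    by apply: ereal_inf_lbound; exists [set s | ~ D s].
  by apply: ge_ereal_sup => _ [s /negP Ds <-]; rewrite ltW// ltNge.
have h1 M : within D (+oo : set_system R) [set s | M <= s].
  by apply: filterS (pinfty_ge M) => s Ms _.
have h2 : within D (+oo : set_system R) D by apply: filterS (pinfty_ge 0).
have [U [A [b [a [_ _ B _ _]]]]] := john_ultra_limit f0 lcf intf PF h1 c0 h2.
by exists A, b, a.
Qed.

Lemma gauss_below_limf_esup_gt0 A b a : gauss_below A b a ->
  (0 < limf_esup (john_svolume f) (+oo)%R)%E.
Proof.
move=> B; have v0 := volume_gt0 B.
have g0 : 0 < gc := gauss_const_gt0 n.
pose v := b * `|\det A| * gc / 2.
have vg0 : 0 < b * `|\det A| * gc by rewrite mulr_gt0.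
have vv : v < b * `|\det A| * gc by rewrite /v; lra.
apply: (@lt_le_trans _ _ v%:E); first by rewrite lte_fin /v; lra.
apply: le_ereal_inf_tmp => _ [V FV <-].
have h := near_lt_john_svolume f0 lcf intf B vv.
have [s [Vs hs]] := filter_ex (filterI FV h).
by apply: le_trans (ltW hs) _; apply: ereal_sup_ubound; exists s.
Qed.

Lemma cvg_john_svolume A0 b0 a0 : gauss_below A0 b0 a0 ->
  exists U A b a, [/\ UltraFilter U, (+oo)%R `<=` U, gauss_below A b a,
    john_svolume f s @[s --> +oo] --> (b * `|\det A| * gc)%:E &
    forall e, 0 < e -> U [set s | forall x,
      `|john_function f s x - profile_density gauss_profile A b a x| <= e]].
Proof.
move=> B0; have g0 : 0 < gc := gauss_const_gt0 n.
pose v := b0 * `|\det A0| * gc / 2.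
have vg0 : 0 < b0 * `|\det A0| * gc by rewrite mulr_gt0// (volume_gt0 B0).
have vv : v < b0 * `|\det A0| * gc by rewrite /v; lra.
have v0 : 0 < v by rewrite /v; lra.
have h : (+oo : set_system R) [set s | (v%:E <= john_svolume f s)%E].
  by apply: filterS (near_lt_john_svolume f0 lcf intf B0 vv) => s /ltW.
have [U [A [b [a [UU sU B jU unif]]]]] :=
  john_ultra_limit f0 lcf intf proper_pinfty_nbhs pinfty_ge v0 h.
exists U, A, b, a; split => //.
have PU : ProperFilter U by exact: (@ultra_proper _ _ UU).
set W := b * `|\det A| * gc in jU *.
have jfin : \forall s \near +oo, john_svolume f s \is a fin_num.
  near=> s; have s2 : 2 <= s by near: s; exact: pinfty_ge.
  have s0 : 0 < s by lra.
  have [E [_ _ -> _]] := ex_john_spec f0 lcf intf s2 (gauss_below_john s0 B).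
  by [].
apply/fine_cvgP; split => //; apply/cvgrPdist_le => e e0.
have lower : \forall s \near +oo, ((W - e)%:E < john_svolume f s)%E.
  have We : W - e < b * `|\det A| * gc by rewrite -/W; lra.
  have hh := near_lt_john_svolume f0 lcf intf B We.
  exact: hh.
(* Were the s-volumes frequently at least [W + e], a second limit Gaussian below [f] would have
   integral at least [W + e]. By [near_lt_john_svolume] it would push all late s-volumes above
   [W + e / 2], against their limit [W] along [U]. *)
have upper : \forall s \near +oo, ~ ((W + e)%:E <= john_svolume f s)%E.
  pose D := [set s | ((W + e)%:E <= john_svolume f s)%E].
  have [//|PF] := @within_proper_or_near R (+oo)%R D (proper_pinfty_nbhs).
  exfalso; have We0 : 0 < W + e.
    by rewrite /W addr_gt0// mulr_gt0// (volume_gt0 B).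
  have h1 M : within D (+oo : set_system R) [set s | M <= s].
    by apply: filterS (pinfty_ge M) => s Ms _.
  have h2 : within D (+oo : set_system R) D by apply: filterS (pinfty_ge 0).
  have [U' [A' [b' [a' [UU' sU' B' jU' _]]]]] := john_ultra_limit f0 lcf intf PF h1 We0
    h2.
  have PU' : ProperFilter U' by exact: (@ultra_proper _ _ UU').
  have sub' : (+oo : set_system R) `<=` U'.
    by move=> V FV; apply: sU'; apply: filterS FV.
  have W' : W + e <= b' * `|\det A'| * gc.
    apply: (cvgr_to_ge jU'); near=> s.
    have : ((W + e)%:E <= john_svolume f s)%E.
      by near: s; exact: sU'.
    rewrite -lee_fin fineK//; near: s; exact: sub'.
  have We : W + e / 2 < b' * `|\det A'| * gc by lra.
  have low := near_lt_john_svolume f0 lcf intf B' We.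
  have : W + e / 2 <= W.
    apply: (cvgr_to_ge jU); near=> s.
    rewrite -lee_fin fineK; last by near: s; exact: sU.
    by apply: ltW; near: s; exact: sU.
  lra.
near=> s; have sf : john_svolume f s \is a fin_num by near: s.
have : ((W - e)%:E < john_svolume f s)%E by near: s.
have : ~ ((W + e)%:E <= john_svolume f s)%E by near: s.
move/negP; rewrite -ltNge -[john_svolume f s]fineK// !lte_fin /= => h1 h2.
by rewrite ler_norml; apply/andP; split; lra.
Unshelve. all: by end_near. Qed.

Lemma gauss_below_volume_le A b a W : gauss_below A b a ->
  john_svolume f s @[s --> +oo] --> W%:E -> b * `|\det A| * gc <= W.
Proof.
move=> B hW; rewrite leNgt; apply/negP => lt.
pose v := (W + b * `|\det A| * gc) / 2.
have vv : v < b * `|\det A| * gc by rewrite /v; lra.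
have low := near_lt_john_svolume f0 lcf intf B vv.
have [hfin hl] := (fine_cvgP _ _).1 hW.
have : v <= W.
  apply: (cvgr_to_ge hl); near=> s; rewrite -lee_fin /= fineK; last by near: s.
  by apply: ltW; near: s.
rewrite /v; lra.
Unshelve. all: by end_near. Qed.

Lemma maximal_gauss_height A b a : gauss_below A b a ->
  (forall A' b' a', gauss_below A' b' a' -> b' * `|\det A'| <= b * `|\det A|) ->
  forall x, f x <= 2 ^+ n * b.
Proof.
move=> [pA b0 below] mx x.
have := f0 x; rewrite le_eqVlt => /orP[/eqP<-|fx0].
  by rewrite mulr_ge0 ?exprn_ge0// ltW.
pose r := ln (f x); have rE : expR r = f x by rewrite /r lnK ?posrE.
have dA := posdefmx_det pA.
have uA : A \in unitmx by rewrite unitmxE unitfE.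
have s20 : 0 < Num.sqrt 2 :> R by rewrite sqrtr_gt0.
pose b' := expR (2^-1 * (ln b + r)).
have b'2 : b' ^+ 2 = b * f x.
  rewrite expr2 -expRD (_ : _ + _ = ln b + r); last by field.
  by rewrite expRD rE lnK ?posrE.
pose A' := (Num.sqrt 2)^-1 *: A; pose a' := 2^-1 *: a + (1 - 2^-1) *: x.
have B' : gauss_below A' b' a'.
  split; [by apply: posdefmxZ => //; rewrite invr_gt0|exact: expR_gt0|move=> z].
  (* [z] is the midpoint of [y] and [x]; the Gaussian below [f] at [y] is averaged with the value at
     [x]. Since [y - a = 2 (z - a')], half of the exponent is [2 |A^-1 (z - a')|^2], whence the
     [sqrt 2] in [A']. *)
  pose y := 2 *: z - x.
  have zE : z = 2^-1 *: y + (1 - 2^-1) *: x.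
    by apply/matrixP => i j; rewrite !mxE; field.
  have yE : y - a = 2 *: (z - a').
    by apply/matrixP => i j; rewrite !mxE; field.
  have fy : expR (ln b - sqnorm (invmx A *m (y - a))) <= f y.
    by rewrite expRD lnK ?posrE//; exact: below.
  have t01 : 0 <= (2^-1 : R) <= 1 by apply/andP; split; lra.
  have fx : expR r <= f x by rewrite rE.
  have := log_concave_expR lcf t01 fy fx; rewrite -zE; apply: le_trans.
  rewrite /profile_density /gauss_profile /b' -expRD ler_expR yE -scalemxAr sqnormZ.
  rewrite invmxZ; last by rewrite unitmxZ ?unitfE ?invr_eq0 ?gt_eqF.
  rewrite invrK -scalemxAl sqnormZ sqr_sqrtr//.
  by set S := sqnorm _; rewrite le_eqVlt; apply/orP; left; apply/eqP; field.
have := mx _ _ _ B'.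
rewrite detZ normrM exprVn normfV normrX (ger0_norm (ltW s20)) mulrA ler_pM2r
  ?normr_gt0//.
rewrite ler_pdivrMr ?exprn_gt0// => h.
have b'0 : 0 <= b' by exact: expR_ge0.
(* Maximality says [b' <= b sqrt 2 ^ n]; with [b'^2 = b f(x)], squaring gives [f(x) <= 2^n b]. *)
have : b' ^+ 2 <= (b * Num.sqrt 2 ^+ n) ^+ 2.
  by rewrite ler_pXn2r// nnegrE ?mulr_ge0 ?exprn_ge0// ltW.
rewrite b'2 exprMn exprAC sqr_sqrtr// expr2 -mulrA ler_pM2l//.
by rewrite mulrC.
Qed.

End john_limit_consequences.

Theorem theorem7p2 (R : realType) (d : nat) (d_gt0 : (0 < d)%N)
    (f : 'cV[R]_d -> R) (f_ge0 : forall x, 0 <= f x)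
    (f_proper : proper_log_concave f) :
  [/\ (exists g, gaussian_density_below f g) <->
        (0 < limf_esup (john_svolume f) (+oo)%R)%E,
      (exists g, gaussian_density_below f g) ->
        (john_svolume f s @[s --> +oo] --> limf_esup (john_svolume f) (+oo)%R) /\
        exists s_ : nat -> R,
          [/\ forall i, 0 < s_ i, s_ i @[i --> \oo] --> +oo &
            exists2 g : 'cV[R]_d -> R, maximal_gaussian_density_below f g &
              {uniform, (fun i => john_function f (s_ i)) @ \oo --> g}] &
      (exists g, gaussian_density_below f g) ->
        forall (g : 'cV[R]_d -> R) (alpha : R),
          maximal_gaussian_density_below f g ->
          gaussian_density_of_height alpha g ->
          (norm_Linfty f * (expR (- d%:R))%:E <= alpha%:E)%E].
Proof.
have [lcf _ /andP[_ intf]] := f_proper.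
have g0 : 0 < @gauss_const R d := gauss_const_gt0 d.
split.
- split=> [[g /gaussian_density_belowP[A [b [a [B _]]]]]|h].
    exact: (gauss_below_limf_esup_gt0 f_ge0 lcf intf B).
  have [A [b [a B]]] := limf_esup_gt0_gauss_below f_ge0 lcf intf h.
  by exists (profile_density gauss_profile A b a); apply/gaussian_density_belowP;
    exists A, b, a.
- move=> [g0' /gaussian_density_belowP[A0 [b0 [a0 [B0 _]]]]].
  have [U [A [b [a [UU sU B hW unif]]]]] := cvg_john_svolume f_ge0 lcf intf B0.
  split; first by rewrite (cvg_limf_esup proper_pinfty_nbhs hW).
  have PU : ProperFilter U by exact: (@ultra_proper _ _ UU).
  pose g := profile_density gauss_profile A b a.
  (* Return from the ultrafilter to a sequence: both conditions hold on sets of [U], which therefore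
     meet. *)
  have ex i : exists s, i.+1%:R <= s /\ forall x,
    `|john_function f s x - g x| <= i.+1%:R^-1.
    have i0 : 0 < i.+1%:R^-1 :> R by rewrite invr_gt0 ltr0n.
    have [s [s1 s2]] := filter_ex (filterI (sU _ (pinfty_ge (i.+1%:R : R))) (unif _ i0)).
    by exists s.
  have [s_ hs] := choice ex.
  exists s_; split=> [i||].
  + by apply: lt_le_trans (hs i).1; rewrite ltr0n.
  + apply/cvgryPge => M; near=> i; apply: le_trans (hs i).1.
    apply: (@le_trans _ _ i%:R); last by rewrite ler_nat.
    by near: i; exact: nbhs_infty_ger.
  + exists g.
      split; first by apply/gaussian_density_belowP; exists A, b, a.
      move=> h /gaussian_density_belowP[A' [b' [a' [B' ->]]]].
      have [pA b1 _] := B; have [pA' b'1 _] := B'.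
      rewrite !integral_gauss_profile// lee_fin.
      exact: (gauss_below_volume_le f_ge0 lcf intf B' hW).
    move=> P /uniform_nbhs[E [+ sub]]; rewrite -entourage_ballE => -[e /= e0 eE].
    near=> i; apply: sub => x _; apply: eE; rewrite /= /ball /= distrC.
    apply: le_lt_trans ((hs i).2 x) _.
    by near: i; exact: near_infty_natSinv_lt (PosNum e0).
- move=> _ g alpha [gb mx] [A [a [pA al0 gE]]].
  have B : profile_below f gauss_profile A alpha a.
    by split => // x; have := gb.2 x; rewrite gE.
  have mx' A' b' a' : profile_below f gauss_profile A' b' a' ->
      b' * `|\det A'| <= alpha * `|\det A|.
    move=> B'; have [pA' b'0 _] := B'.
    have : (integral_Rn (profile_density gauss_profile A' b' a') <= integral_Rn g)%E.
      by apply: mx; apply/gaussian_density_belowP; exists A', b', a'.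
    rewrite gE -[gaussian A alpha a]/(profile_density gauss_profile A alpha a).
    by rewrite !integral_gauss_profile// lee_fin ler_pM2r.
  have fle := maximal_gauss_height f_ge0 lcf B mx'.
  have e2 : 2 ^+ d <= expR d%:R :> R.
    rewrite -[d%:R]mulr1 mulrC expRM powR_mulrn ?expR_ge0//.
    by apply: lerXn2r; rewrite ?nnegrE ?expR_ge0//; have := expR_ge1Dx (1 : R); lra.
  (* The pointwise bound on [f] passes to the essential supremum; in the other case of the
     definition the norm is 0. *)
  have N : (norm_Linfty f <= (alpha * expR d%:R)%:E)%E.
    rewrite /norm_Linfty unlock; case: ifP => [_|_]; last first.
      by rewrite lee_fin mulr_ge0 ?expR_ge0// ltW.
    apply/ess_supP; apply: nearW => t; rewrite /= lee_fin ger0_norm//.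
    by apply: le_trans (fle _) _; rewrite mulrC ler_wpM2l// ltW.
  apply: le_trans (lee_wpmul2r _ N) _; first by rewrite lee_fin expR_ge0.
  by rewrite -EFinM -mulrA -expRD subrr expR0 mulr1.
Unshelve. all: by end_near. Qed.
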